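(* Let $q,z$ be complex numbers with $0<|q|<1$, $z\neq 0$, and $z\ne q^{m}$ for every nonzero integer $m$. For every integer $k\geq 2$, \begin{align*} &(zq, z^{-1}q,q;q)_{\infty}\sum_{n=0}^{\infty}\frac{(q^2;q)_{2n}q^n}{(zq;q)_n(z^{-1}q;q)_{n+1}}\\ &\qquad\times\sum_{n_1,\ldots,n_{k-1}=0}^{\infty}\frac{q^{N_1^2+\cdots+N_{k-2}^2+\frac{3}{2}N_{k-1}^2+2(N_1+\cdots+N_{k-2})+\frac{3}{2}N_{k-1}}(-q;q)_{n_{k-1}}}{(q;q)_{n-N_1}(q;q)_{n_1}\cdots(q;q)_{n_{k-2}}(q^2;q)_{2n_{k-1}}}\\ &=\sum_{n=0}^{\infty}\left(\sum_{m=0}^{[n/2]}(-1)^{m+n}z^{n-2m}q^{\frac{1}{2}(n^2-2m^2)+\frac{1}{2}n+4(k-1)(m^2+m)}\right.\\ &\qquad\qquad\left.+\sum_{m=1}^{[n/2]}(-1)^{m+n}z^{2m-n-1}q^{\frac{1}{2}(n^2-2m^2)+\frac{1}{2}n+4(k-1)(m^2-m)}\right), \end{align*} where $N_j=n_j+n_{j+1}+\cdots+n_{k-1}$ for $1\le j\le k-1$.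
   Context: Notation: $(a;q)_\infty=\prod_{n=0}^\infty(1-aq^n)$, $(a;q)_n=\dfrac{(a;q)_\infty}{(aq^n;q)_\infty}$ (so $(a;q)_n=\prod_{i=0}^{n-1}(1-aq^i)$ for $n\ge 0$), and $(a_1,\ldots,a_k;q)_\infty=(a_1;q)_\infty\cdots(a_k;q)_\infty$. $[x]$ denotes the integer part (floor) of $x$; empty sums are $0$. As usual $1/(q;q)_{n}=0$ for negative integers $n$, so only terms with $N_1\le n$ contribute to the inner multiple sum. When $k=2$, the expressions $N_1^2+\cdots+N_{k-2}^2$ and $N_1+\cdots+N_{k-2}$ are empty (equal to $0$) and the product $(q;q)_{n_1}\cdots(q;q)_{n_{k-2}}$ is empty (equal to $1$). *)

(* Defs.v *)
From HB Require Import structures.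
From mathcomp Require Import all_boot all_order all_algebra complex.
From mathcomp Require Import all_classical all_reals all_analysis.

Set Implicit Arguments.
Unset Strict Implicit.
Unset Printing Implicit Defensive.

Import Order.TTheory GRing.Theory Num.Theory.
Import numFieldNormedType.Exports.

Local Open Scope classical_set_scope.
Local Open Scope ring_scope.

(* The definitions are generic in a numFieldType C, whose topology is the one
   of its norm; this lets them be used at C := R[i], on which this topology
   is not inferred directly. *)

Definition series_cvg (C : numFieldType) (u : nat -> C) : Prop :=
  cvgn (series u).

(* Meaningful only when series_cvg u holds (lim is total). *)
Definition series_sum (C : numFieldType) (u : nat -> C) : C :=
  limn (series u).

Definition qpoch (C : numFieldType) (a q : C) (n : nat) : C :=
  \prod_(i < n) (1 - a * q ^+ i).

Definition qpochoo (C : numFieldType) (a q : C) : C :=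
  limn (qpoch a q).

(* 1 / (q; q)_m, with the convention that it vanishes for m < 0. *)
Definition inv_qfact (C : numFieldType) (q : C) (m : int) : C :=
  if m is Posz p then (qpoch q q p)^-1 else 0.

(* A tuple t : (k - 1).-tuple nat holds (n_1, ..., n_(k-1)); subscripts are
   1-based, as in the usual notation. *)
Definition part (k : nat) (t : (k - 1).-tuple nat) (j : nat) : nat :=
  nth 0%N t j.-1.

Definition tail (k : nat) (t : (k - 1).-tuple nat) (j : nat) : nat :=
  (\sum_(j <= i < k) part t i)%N.

(* The division by 2 is exact. *)
Definition inner_expo (k : nat) (t : (k - 1).-tuple nat) : nat :=
  (\sum_(1 <= j < k - 1) tail t j ^ 2
   + (3 * tail t (k - 1) ^ 2 + 3 * tail t (k - 1)) %/ 2
   + 2 * \sum_(1 <= j < k - 1) tail t j)%N.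

Definition inner_term (C : numFieldType) (q : C) (k n : nat)
    (t : (k - 1).-tuple nat) : C :=
  q ^+ inner_expo t * qpoch (- q) q (part t (k - 1))
  * inv_qfact q (n%:Z - (tail t 1)%:Z)
  / (\prod_(1 <= j < k - 1) qpoch q q (part t j)
     * qpoch (q ^+ 2) q (2 * part t (k - 1))).

(* A sum over all tuples of naturals; its support is finite, because inv_qfact
   vanishes unless n_1 + ... + n_(k-1) <= n. *)
Definition inner_sum (C : numFieldType) (q : C) (k n : nat) : C :=
  \sum_(t \in [set: (k - 1).-tuple nat]) inner_term q n t.

Definition lhs_term (C : numFieldType) (q z : C) (k n : nat) : C :=
  qpoch (q ^+ 2) q (2 * n) * q ^+ n
  / (qpoch (z * q) q n * qpoch (z^-1 * q) q n.+1)
  * inner_sum q k n.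

(* (n^2 - 2 m^2) / 2 + n / 2; the division is exact. *)
Definition rhs_expo (n m : nat) : int :=
  ((n%:Z ^+ 2 - 2 * m%:Z ^+ 2 + n%:Z) %/ 2)%Z.

Definition rhs_term (C : numFieldType) (q z : C) (k n : nat) : C :=
  \sum_(0 <= m < (n %/ 2).+1)
    (-1) ^+ (m + n) * z ^ (n%:Z - 2 * m%:Z)
    * q ^ (rhs_expo n m + 4 * (k%:Z - 1) * (m%:Z ^+ 2 + m%:Z))
  + \sum_(1 <= m < (n %/ 2).+1)
    (-1) ^+ (m + n) * z ^ (2 * m%:Z - n%:Z - 1)
    * q ^ (rhs_expo n m + 4 * (k%:Z - 1) * (m%:Z ^+ 2 - m%:Z)).

(* Main.v *)
(* The Bailey transform for a = q^2.  Iterating the Bailey lemma k - 1 times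
   (each step is the q-Chu-Vandermonde sum) from the pair supported on even indices
   beta_n = q^(n choose 2) (-q; q)_n / (q^2; q)_(2 n) writes the inner sum as
     sum_m alpha_m / ((q; q)_(n - 2 m) (q^3; q)_(n + 2 m)),
     alpha_m = (-1)^m q^(m (m - 1) + (k - 1) (4 m^2 + 4 m)) (1 - q^(4 m + 2)) / (1 - q^2).
   After exchanging the sums, n = 2 m + s, the sum over s is, with a = z q^(2 m + 1) and
   b = z^-1 q^(2 m + 2), the left side of Warnaar's identity
     (q, a, b; q)_oo sum_s (a b / q; q)_(2 s) q^s / ((q, a, b, a b; q)_s) = th(a) + th(b) - 1,
     th(a) = sum_s (-1)^s a^s q^(s choose 2).
   Call S(a, b) the left side. Its mixed difference S(a, b) - S(a q, b) - S(a, b q) + S(a q, b q)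
   telescopes to 0, so S(a, b) = S(a, 0) + S(b, 0) - S(0, 0) by continuity, and
   S(a, 0) + a S(a q, 0) = 1 also telescopes, which gives S(a, 0) = th(a). *)
Require Import Defs.
From mathcomp Require Import all_boot all_order all_algebra complex.
From mathcomp Require Import all_classical all_reals all_analysis.
From mathcomp Require Import ring zify.
Set Implicit Arguments.
Unset Strict Implicit.
Unset Printing Implicit Defensive.
Import Order.TTheory GRing.Theory Num.Theory.
Import numFieldNormedType.Exports.
Local Open Scope classical_set_scope.
Local Open Scope ring_scope.

(** * Finite q-series and the Bailey lemma *)

Section QAlgebra.
Variables (C : numFieldType) (q : C).

Lemma qpoch0 (a : C) : qpoch a q 0 = 1.
Proof. by rewrite /qpoch big_ord0. Qed.

Lemma qpochS (a : C) n : qpoch a q n.+1 = qpoch a q n * (1 - a * q ^+ n).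
Proof. by rewrite /qpoch big_ord_recr. Qed.

Lemma qpochD (a : C) m n : qpoch a q (m + n) = qpoch a q m * qpoch (a * q ^+ m) q n.
Proof.
elim: n => [|n IH]; first by rewrite addn0 qpoch0 mulr1.
by rewrite addnS !qpochS IH exprD; ring.
Qed.

Lemma qpochSl (a : C) n : qpoch a q n.+1 = (1 - a) * qpoch (a * q) q n.
Proof. by rewrite -add1n qpochD qpochS qpoch0 expr0 expr1; ring. Qed.

Lemma qpoch_neq0 (a : C) n : (forall i, a * q ^+ i != 1) -> qpoch a q n != 0.
Proof.
move=> h; rewrite /qpoch prodf_seq_neq0; apply/allP => i _ /=.
by rewrite subr_eq0 eq_sym h.
Qed.

Local Notation iq n j := (inv_qfact q (Posz n - Posz j)).

Lemma inv_qfact_le n j : (j <= n)%N -> iq n j = (qpoch q q (n - j))^-1.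
Proof. by move=> h; rewrite subzn. Qed.

Lemma inv_qfact_gt n j : (n < j)%N -> iq n j = 0.
Proof. by move=> h; case E: (Posz n - Posz j) => [p|p] //; lia. Qed.

Hypothesis q_neq0 : q != 0.
Hypothesis q_nroot : forall n, q ^+ n.+1 != 1.

Lemma qpochX_neq0 m n : qpoch (q ^+ m.+1) q n != 0.
Proof. by apply: qpoch_neq0 => i; rewrite -exprD addSn. Qed.

Lemma qpochq_neq0 n : qpoch q q n != 0.
Proof. exact: (qpochX_neq0 0). Qed.

Lemma subX_neq0 n : 1 - q ^+ n.+1 != 0.
Proof. by rewrite subr_eq0 eq_sym. Qed.

(** Multiplying by [q ^+ j] avoids negative exponents and makes the rule hold for every j: at j = n
    + 1 the factor [q ^+ j - q ^+ n.+1] vanishes, and beyond that both reciprocals are 0. *)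
Lemma inv_qfact_up n j : q ^+ j * iq n j = (q ^+ j - q ^+ n.+1) * iq n.+1 j.
Proof.
case: (leqP j n) => [h|h].
  rewrite !inv_qfact_le ?(leqW h) // subSn // qpochS -exprS.
  have -> : q ^+ n.+1 = q ^+ (n - j).+1 * q ^+ j by rewrite -exprD; congr (_ ^+ _); lia.
  have h2 := subX_neq0 (n - j); have h1 := qpochq_neq0 (n - j).
  by field; rewrite h1 h2.
rewrite (inv_qfact_gt h) mulr0; case: (ltngtP j n.+1) => h2; first by lia.
  by rewrite (inv_qfact_gt h2) mulr0.
by rewrite h2 subrr mul0r.
Qed.

Lemma inv_qfact_down n j : q ^+ j * iq n j.+1 = (q ^+ j - q ^+ n) * iq n j.
Proof.
case: (ltngtP n j) => h.
- by rewrite !inv_qfact_gt ?mulr0 ?(ltnW h)//; lia.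
- rewrite !inv_qfact_le ?(ltnW h) // -[(n - j)%N]prednK ?subn_gt0 //.
  rewrite subnS qpochS -exprS prednK ?subn_gt0 //.
  have h1 := qpochq_neq0 (n - j).-1.
  have h2 : 1 - q ^+ (n - j) != 0 by rewrite -[(n - j)%N]prednK ?subn_gt0 // subX_neq0.
  rewrite -{2}(subnKC (ltnW h)) exprD.
  by field; rewrite h1 h2.
- by rewrite h subrr mul0r inv_qfact_gt ?mulr0.
Qed.

(* Induction on N for all A at once: the q-Pascal rule gives
   (1 - q^(N+1)) f_(N+1)(A) = f_N(A) + A q^(N+1) / (1 - A q) f_N(A q). *)
Lemma q_vandermonde (A : C) (N : nat) : (forall i, A * q ^+ i.+1 != 1) ->
  \sum_(j < N.+1) A ^+ j * q ^+ (j ^ 2) * iq N j / (qpoch q q j * qpoch (A * q) q j)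
  = (qpoch q q N * qpoch (A * q) q N)^-1.
Proof.
elim: N A => [|N IH] A hA.
  rewrite big_ord_recl big_ord0 addr0 inv_qfact_le // subnn !qpoch0 /=. by rewrite !expr0 ; field.
have hA' i : A * q * q ^+ i.+1 != 1 by rewrite -mulrA -exprS hA.
have pA n : qpoch (A * q) q n != 0.
  by apply: qpoch_neq0 => i; rewrite -mulrA -exprS.
have pA' n : qpoch (A * q * q) q n != 0.
  by apply: qpoch_neq0 => i; rewrite -mulrA -exprS.
have hq := qpochq_neq0; have hX := subX_neq0 N.
have hAq : 1 - A * q != 0 by rewrite subr_eq0 eq_sym; have := hA 0%N; rewrite expr1.
apply: (mulfI hX).
pose f N' (A' : C) (j : nat) :=
  A' ^+ j * q ^+ (j ^ 2) * iq N' j / (qpoch q q j * qpoch (A' * q) q j).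
(* This is 1 - q^(N+1) = (1 - q^(N+1-j)) + q^(N+1-j) (1 - q^j). The first part lowers N; the second
   vanishes at j = 0, so its index can be shifted. *)
have split_term j : (1 - q ^+ N.+1) * f N.+1 A j =
    f N A j + A ^+ j * q ^+ (j ^ 2) * q ^+ N.+1 * (iq N.+1 j / q ^+ j)
      * (1 - q ^+ j) / (qpoch q q j * qpoch (A * q) q j).
  have e : iq N j = (1 - q ^+ N.+1 / q ^+ j) * iq N.+1 j.
    by apply: (mulfI (expf_neq0 j q_neq0)); rewrite inv_qfact_up; field; rewrite expf_neq0.
  rewrite /f e; have := hq j; have := pA j; have := expf_neq0 j q_neq0.
  by move=> h1 h2 h3; field; rewrite h1 h2 h3.
rewrite mulr_sumr (eq_bigr _ (fun (j : 'I_N.+2) _ => split_term j)) big_split /=.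
rewrite big_ord_recr /= {2}/f inv_qfact_gt // mulr0 mul0r addr0.
have -> : \sum_(j < N.+1) f N A j = (qpoch q q N * qpoch (A * q) q N)^-1 by exact: IH.
rewrite big_ord_recl /= subrr mulr0 mul0r add0r.
have shift_term j : A ^+ j.+1 * q ^+ (j.+1 ^ 2) * q ^+ N.+1 * (iq N.+1 j.+1 / q ^+ j.+1)
      * (1 - q ^+ j.+1) / (qpoch q q j.+1 * qpoch (A * q) q j.+1)
    = A * q ^+ N.+1 / (1 - A * q) * f N (A * q) j.
  have -> : iq N.+1 j.+1 = iq N j by congr inv_qfact; lia.
  rewrite /f qpochS [qpoch (A * q) q j.+1]qpochSl.
  have -> : (j.+1 ^ 2 = j ^ 2 + j + j.+1)%N by lia.
  rewrite !exprD exprMn !exprS.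
  have := hq j; have := pA' j; have := expf_neq0 j q_neq0; have := subX_neq0 j.
  by rewrite exprS => h1 h2 h3 h4; field; rewrite h1 h2 h3 h4 hAq q_neq0.
rewrite (eq_bigr (fun j : 'I_N.+1 => A * q ^+ N.+1 / (1 - A * q) * f N (A * q) j)); last first.
  by move=> j _; exact: shift_term.
rewrite -mulr_sumr.
have -> : \sum_(j < N.+1) f N (A * q) j = (qpoch q q N * qpoch (A * q * q) q N)^-1 by exact: IH.
have pS : 1 - A * q * q ^+ N != 0 by have := pA N.+1; rewrite qpochS mulf_eq0 negb_or => /andP[].
have -> : qpoch (A * q * q) q N = qpoch (A * q) q N * (1 - A * q * q ^+ N) / (1 - A * q).
  by rewrite -qpochS qpochSl; field; rewrite hAq.
move: hX; rewrite !qpochS !exprS => hX; have := hq N; have := pA N.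
by move=> h1 h2; field; rewrite h1 h2 hAq hX pS.
Qed.

(** * The initial Bailey pair *)

Definition base_alpha (m : nat) : C :=
  (-1) ^+ m * q ^+ (m * m.-1) * (1 - q ^+ (4 * m + 2)) / (1 - q ^+ 2).

Definition base_beta (n : nat) : C :=
  q ^+ 'C(n, 2) * qpoch (- q) q n / qpoch (q ^+ 2) q (2 * n).

(** Since 1 - q^(2n+2) = (1 - q^(n+1)) (1 + q^(n+1)), the new factor of (-q; q)_(n+1) cancels.
    [certS] shows that the alpha side obeys the same recurrence in n. *)
Lemma base_betaS n :
  (1 - q ^+ n.+1) * (1 - q ^+ (2 * n + 3)) * base_beta n.+1 = q ^+ n * base_beta n.
Proof.
rewrite /base_beta binS bin1 exprD [qpoch (- q) q n.+1]qpochS.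
have -> : (2 * n.+1 = (2 * n).+2)%N by lia.
rewrite !qpochS.
have := qpochX_neq0 1 (2 * n).+2.
rewrite !qpochS !mulf_eq0 !negb_or => /andP[/andP[h1 h2] h3].
move: h2 h3; rewrite -!exprD => h2 h3.
have -> : (2 * n + 3 = 2 + (2 * n).+1)%N by lia.
have e : 1 - q ^+ (2 + 2 * n) = (1 - q ^+ n.+1) * (1 + q ^+ n.+1).
  have -> : (2 + 2 * n = n.+1 + n.+1)%N by lia.
  by rewrite exprD; ring.
move: h2; rewrite e mulf_eq0 negb_or => /andP[h4 h5].
rewrite mulNr -exprS (exprD q _ n).
move: (q ^+ _) (q ^+ n.+1) (q ^+ n) (qpoch _ _ _) (q ^+ (2 + _)) (qpoch _ _ _) h1 h3 h4 h5
  => a b c d f g h1 h3 h4 h5.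
by field; rewrite h1 h3 h4 h5.
Qed.

(* The telescoping certificate of the 6phi5-type sum below. *)
Let cert n m : C := (-1) ^+ m * q ^+ (m * m.-1) * (q ^+ (2 * m) - 1)
  * (1 - q ^+ (n + 2 + 2 * m)) * (1 - q ^+ (n + 3 + 2 * m)) / (1 - q ^+ 2)
  * iq n.+1 (2 * m) / qpoch (q ^+ 3) q (n.+1 + 2 * m).

Let certS n m :
  (1 - q ^+ n.+1) * (1 - q ^+ (2 * n + 3))
    * (base_alpha m * iq n.+1 (2 * m) / qpoch (q ^+ 3) q (n.+1 + 2 * m))
  - q ^+ n * (base_alpha m * iq n (2 * m) / qpoch (q ^+ 3) q (n + 2 * m))
  = cert n m.+1 - cert n m.
Proof.
have qX i : q ^+ i != 0 by rewrite expf_neq0.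
have e0 : iq n (2 * m) = (1 - q ^+ n.+1 / q ^+ (2 * m)) * iq n.+1 (2 * m).
  by apply: (mulfI (qX (2 * m)%N)); rewrite inv_qfact_up; field; rewrite qX.
have e1 j : iq n.+1 j.+1 = (1 - q ^+ n.+1 / q ^+ j) * iq n.+1 j.
  by apply: (mulfI (qX j)); rewrite inv_qfact_down; field; rewrite qX.
have e2 : (2 * m.+1 = (2 * m).+2)%N by lia.
rewrite /cert /base_alpha e2 !e1 e0 -pred_Sn.
have -> : (m.+1 * m = m * m.-1 + 2 * m)%N by case: m {e0 e2} => //= m; lia.
have -> : (n.+1 + (2 * m).+2 = (n + 2 * m).+3)%N by lia.
have -> : (n.+1 + (2 * m) = (n + 2 * m).+1)%N by lia.
have h := qpochX_neq0 2 (n + 2 * m).+3.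
have h2 : 1 - q ^+ 2 != 0 by exact: subX_neq0.
move: h; rewrite !qpochS !mulf_eq0 !negb_or => /andP[/andP[/andP[h3 h4] h5] h6].
(* All exponents are rewritten as sums of m, n and constants, which leaves a rational identity in q,
   q^m and q^n. *)
move: h3 h4 h5 h6.
have -> : (4 * m + 2 = 2 + (m + m) + (m + m))%N by lia.
have -> : (2 * n + 3 = 3 + n + n)%N by lia.
have -> : (n + 2 + (2 * m).+2 = (m + m) + n + 4)%N by lia.
have -> : (n + 3 + (2 * m).+2 = (m + m) + n + 5)%N by lia.
have -> : (n + 2 + (2 * m) = (m + m) + n + 2)%N by lia.
have -> : (n + 3 + (2 * m) = (m + m) + n + 3)%N by lia.
have -> : (2 * m = m + m)%N by lia.
move: (qX m) (qX n); rewrite !exprS !exprD expr0 !mulr1.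
set u := q ^+ n; set v := q ^+ m; set S := q ^+ (m * m.-1).
set Q := qpoch _ _ _; set I := iq _ _; set e := (-1) ^+ m.
move=> hv hu h3 h4 h5 h6.
move: h2; rewrite !exprS !expr0 !mulr1 => h2.
by field; rewrite h4 h3 h2 h6 h5 hv q_neq0.
Qed.

(** Creative telescoping: summed over m, the defect of the recurrence is [cert n M - cert n 0]. The
    factor q^(2m) - 1 kills [cert] at m = 0, and [inv_qfact] kills it at m = M, where 2 M exceeds
    the upper index. *)
Lemma base_pair n M : (n < 2 * M)%N ->
  base_beta n = \sum_(m < M) base_alpha m * iq n (2 * m) / qpoch (q ^+ 3) q (n + 2 * m).
Proof.
elim: n => [|n IH] nM.
  case: M nM => // M _; rewrite big_ord_recl big1; last first.
    by move=> i _; rewrite inv_qfact_gt ?mulr0 ?mul0r.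
  rewrite addr0 inv_qfact_le //= /base_beta /base_alpha ?muln0 ?subn0 !qpoch0 !expr0.
  by field; exact: subX_neq0.
have c_neq0 : (1 - q ^+ n.+1) * (1 - q ^+ (2 * n + 3)) != 0.
  by rewrite mulf_neq0 // ?subX_neq0 // addnS subX_neq0.
apply: (mulfI c_neq0); rewrite base_betaS IH ?(ltnW nM) //.
apply/eqP; rewrite eq_sym -subr_eq0 !mulr_sumr -sumrB; apply/eqP.
rewrite (eq_bigr _ (fun (m : 'I_M) _ => certS n m)).
rewrite -(big_mkord xpredT (fun m => cert n m.+1 - cert n m)) telescope_sumr //.
by rewrite /cert (@inv_qfact_gt n.+1 (2 * M)) // muln0 expr0 (subrr 1) !(mulr0, mul0r) subrr.
Qed.

(** The Bailey lemma for a = q^2 with both free parameters sent to infinity, so that the weight is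
    a^s q^(s^2). Terms with s < r vanish; s = r + j turns the rest into [q_vandermonde] with A =
    q^(2+2r) and N = n - r. *)
Lemma bailey_kernel n r :
  \sum_(s < n.+1) q ^+ (s ^ 2 + 2 * s) * iq n s * (iq s r / qpoch (q ^+ 3) q (s + r))
  = q ^+ (r ^ 2 + 2 * r) * iq n r / qpoch (q ^+ 3) q (n + r).
Proof.
case: (leqP r n) => rn; last first.
  rewrite (inv_qfact_gt rn) mulr0 mul0r big1 // => s _.
  by rewrite (@inv_qfact_gt s) ?mul0r ?mulr0 //; have := ltn_ord s; lia.
rewrite -(big_mkord xpredT (fun s => q ^+ (s ^ 2 + 2 * s) * iq n s *
  (iq s r / qpoch (q ^+ 3) q (s + r)))).
rewrite (big_cat_nat (n := r)) ?leqW //= big_nat_cond big1 ?add0r; last first.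
  by move=> s; rewrite andbT => sr; rewrite (@inv_qfact_gt s) ?mul0r ?mulr0.
rewrite -{1}[r]add0n big_addn subSn // big_mkord.
set N := (n - r)%N; set A := q ^+ (2 + 2 * r).
have hA i : A * q ^+ i.+1 != 1 by rewrite /A -exprD addnS q_nroot.
have Aq : A * q = q ^+ 3 * q ^+ (2 * r) by rewrite /A -!exprD -exprSr; congr (_ ^+ _); lia.
have p3 := qpochX_neq0 2 (2 * r).
rewrite (eq_bigr (fun j : 'I_N.+1 => q ^+ (r ^ 2 + 2 * r) / qpoch (q ^+ 3) q (2 * r) *
  (A ^+ j * q ^+ (j ^ 2) * iq N j / (qpoch q q j * qpoch (A * q) q j)))).
  rewrite -mulr_sumr q_vandermonde // Aq inv_qfact_le // -/N.
  have -> : (n + r = 2 * r + N)%N by rewrite /N; lia.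
  by rewrite [in RHS]qpochD !invfM; ring.
move=> j _.
have -> : iq n (j + r) = iq N j by congr inv_qfact; rewrite /N; lia.
rewrite (inv_qfact_le (leq_addl j r)) addnK.
have -> : (j + r + r = 2 * r + j)%N by lia.
rewrite qpochD -Aq /A -exprM.
have -> : ((j + r) ^ 2 + 2 * (j + r) = (r ^ 2 + 2 * r) + (2 + 2 * r) * j + j ^ 2)%N by lia.
by rewrite [q ^+ (_ + _ + _)]exprD [q ^+ (_ + (_ + _) * _)]exprD !invfM; ring.
Qed.

(* A Bailey pair relative to a = q^2 with alpha_r = 0 for odd r and alpha m standing for
   alpha_(2 m); the bound M is free because the terms with 2 m > n vanish. *)
Definition even_bailey_pair (alpha beta : nat -> C) : Prop :=
  forall n M, (n < M)%N ->
  beta n = \sum_(m < M) alpha m * iq n (2 * m) / qpoch (q ^+ 3) q (n + 2 * m).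

Lemma bailey_step alpha beta : even_bailey_pair alpha beta ->
  even_bailey_pair (fun m => q ^+ (4 * m ^ 2 + 4 * m) * alpha m)
    (fun n => \sum_(s < n.+1) q ^+ (s ^ 2 + 2 * s) * iq n s * beta s).
Proof.
move=> h n M nM.
have e (s : 'I_n.+1) : q ^+ (s ^ 2 + 2 * s) * iq n s * beta s =
  \sum_(m < M) alpha m * (q ^+ (s ^ 2 + 2 * s) * iq n s *
     (iq s (2 * m) / qpoch (q ^+ 3) q (s + 2 * m))).
  rewrite (h s M); last by have := ltn_ord s; lia.
  by rewrite mulr_sumr; apply: eq_bigr => m _; ring.
rewrite (eq_bigr _ (fun s _ => e s)) exchange_big /=; apply: eq_bigr => m _.
rewrite -mulr_sumr bailey_kernel.
have -> : ((2 * m) ^ 2 + 2 * (2 * m) = 4 * m ^ 2 + 4 * m)%N by lia.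
by ring.
Qed.

End QAlgebra.

(** * The multiple sum *)

(** A finite box of tuples that can be peeled one entry at a time, for an induction on the number of
    summation variables. *)
Fixpoint tuple_box (B m : nat) : seq (m.-tuple nat) :=
  if m is m'.+1 then [seq cons_tuple x t | x <- iota 0 B.+1, t <- tuple_box B m']
  else [:: [tuple]].

Lemma tuple_boxS B m : tuple_box B m.+1 =
  [seq cons_tuple x t | x <- iota 0 B.+1, t <- tuple_box B m].
Proof. by []. Qed.

Lemma mem_tuple_box B m (t : m.-tuple nat) :
  (t \in tuple_box B m) = all (fun x => x <= B)%N t.
Proof.
elim: m t => [|m IH] t; first by rewrite tuple0 inE eqxx.
have et : t = cons_tuple (thead t) (behead_tuple t).
  by rewrite {1}[t]tuple_eta; exact: val_inj.
rewrite tuple_boxS [in RHS]et [RHS]/= -(IH (behead_tuple t)).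
apply/allpairsP/andP => [[[x u] []]|[h1 h2]].
  rewrite mem_iota add0n ltnS /= => xB uB ->.
  have -> : behead_tuple (cons_tuple x u) = u by exact: val_inj.
  by rewrite theadE.
by exists (thead t, behead_tuple t); split; rewrite // mem_iota add0n ltnS.
Qed.

Lemma tuple_box_uniq B m : uniq (tuple_box B m).
Proof.
elim: m => // m IH; rewrite tuple_boxS; apply: allpairs_uniq => //.
  exact: iota_uniq.
by move=> [x t] [y u] _ _ /= /(congr1 val) /= [-> /val_inj ->].
Qed.

Section InnerSum.
Variables (C : numFieldType) (q : C).
Local Notation iq n j := (inv_qfact q (Posz n - Posz j)).

(** An entry above B forces N_1 > n, where 1/(q; q)_(n - N_1) is 0. With B free, the inner sums at
    all s <= n can share one box. *)
Lemma inner_sum_box j B n : (n <= B)%N ->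
  inner_sum q j.+2 n = \sum_(t <- tuple_box B j.+1) @inner_term C q j.+2 n t.
Proof.
move=> nB; rewrite /inner_sum (fsbigE (tuple_box B j.+1)) //.
- by apply: eq_bigl => t; exact: mem_set.
- exact: tuple_box_uniq.
move=> t _; rewrite mem_tuple_box => /allPn [x xt]; rewrite -ltnNge => Bx.
rewrite /inner_term inv_qfact_gt ?mulr0 ?mul0r //.
apply: leq_ltn_trans nB (leq_trans Bx _).
rewrite /tail /part big_add1 /= big_mkord.
have xs : (index x t < j.+1)%N by have := xt; rewrite -index_mem size_tuple.
rewrite (bigD1 (Ordinal xs)) //=.
by rewrite nth_index ?leq_addr.
Qed.

(** Replaces the variable n_1 by N_1 = n_1 + T, where T is the sum of the other parts; both index
    windows contain the whole support. *)
Lemma sum_shift_supp (F : nat -> C) T n :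
  (forall s, (s < T)%N -> F s = 0) -> (forall s, (n < s)%N -> F s = 0) ->
  \sum_(x < n.+1) F (x + T)%N = \sum_(s < n.+1) F s.
Proof.
move=> h1 h2.
have z1 : \sum_(0 <= s < T) F s = 0.
  by rewrite big_nat_cond big1 // => s; rewrite andbT => /h1.
have z2 : \sum_(n.+1 <= s < n.+1 + T) F s = 0.
  by rewrite big_nat_cond big1 // => s; rewrite andbT => /andP[/h2].
transitivity (\sum_(0 <= s < n.+1 + T) F s).
  rewrite (big_cat_nat (n := T)) ?leq_addl //= z1 add0r.
  by rewrite -[X in \sum_(X <= _ < _) _]add0n big_addn addnK big_mkord.
by rewrite (big_cat_nat (n := n.+1)) ?leq_addr //= z2 addr0 big_mkord.
Qed.

(** Prepending x leaves the later N_j unchanged and adds N_1 = s. The factor 1/(q; q)_(n_1)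
    reappears as 1/(q; q)_(s - N_2), so what is left is the summand of the shorter sum with s in
    place of n. *)
Lemma inner_term_cons j n x (t : j.+1.-tuple nat) (s := (x + @tail j.+2 t 1)%N) :
  @inner_term C q j.+3 n (cons_tuple x t)
  = q ^+ (s ^ 2 + 2 * s) * iq n s * @inner_term C q j.+2 s t.
Proof.
have tailS i : @tail j.+3 (cons_tuple x t) i.+2 = @tail j.+2 t i.+1.
  by rewrite /tail big_add1 /=; apply: eq_big_nat => -[].
have tail1 : @tail j.+3 (cons_tuple x t) 1 = s.
  rewrite /s /tail big_ltn // big_add1 /=; congr (_ + _)%N.
  by apply: eq_big_nat => -[].
have exps : @inner_expo j.+3 (cons_tuple x t) = (s ^ 2 + 2 * s + @inner_expo j.+2 t)%N.
  rewrite /inner_expo -[(j.+3 - 1)%N]/(j.+2) -[(j.+2 - 1)%N]/(j.+1) tailS.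
  rewrite (@big_ltn _ _ _ 1 j.+2) // (@big_ltn _ _ _ 1 j.+2) // tail1 !big_add1 /=.
  by under eq_bigr do rewrite tailS; under [X in (2 * (_ + X))%N]eq_bigr do rewrite tailS; lia.
rewrite /inner_term exps tail1.
have -> : iq s (@tail j.+2 t 1) = (qpoch q q x)^-1 by rewrite inv_qfact_le ?leq_addl // /s addnK.
rewrite -[(j.+3 - 1)%N]/(j.+2) -[(j.+2 - 1)%N]/(j.+1).
rewrite [X in _ / (X * _) = _]big_ltn // !big_add1 /=.
by rewrite /part /= (exprD q (s ^ 2 + 2 * s)) !invfM; ring.
Qed.

Lemma inner_sumS j n : inner_sum q j.+3 n =
  \sum_(s < n.+1) q ^+ (s ^ 2 + 2 * s) * iq n s * inner_sum q j.+2 s.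
Proof.
rewrite (inner_sum_box _ (leqnn n)) tuple_boxS big_allpairs_dep exchange_big.
rewrite (eq_bigr (fun t => \sum_(s < n.+1) q ^+ (s ^ 2 + 2 * s) * iq n s *
  @inner_term C q j.+2 s t)).
  rewrite exchange_big /=; apply: eq_bigr => s _.
  by rewrite (inner_sum_box _ (B := n)) ?mulr_sumr // -ltnS.
move=> t _; rewrite -[iota 0 n.+1]/(index_iota 0 n.+1) big_mkord.
rewrite -(@sum_shift_supp (fun s => q ^+ (s ^ 2 + 2 * s) * iq n s *
  @inner_term C q j.+2 s t) (@tail j.+2 t 1)).
- by apply: eq_bigr => x _; exact: inner_term_cons.
- by move=> s h; rewrite /inner_term (inv_qfact_gt _ h) mulr0 mul0r mulr0.
- by move=> s h; rewrite (inv_qfact_gt _ h) mulr0 mul0r.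
Qed.

(** The half-integral exponent 3 s (s + 1) / 2 equals (s^2 + 2 s) + s (s - 1) / 2: the weight of one
    Bailey step plus the power of q in [base_beta]. *)
Lemma inner_sum2 n : inner_sum q 2 n =
  \sum_(s < n.+1) q ^+ (s ^ 2 + 2 * s) * iq n s * base_beta q s.
Proof.
rewrite (inner_sum_box _ (leqnn n)) tuple_boxS big_allpairs_dep.
rewrite -[iota 0 n.+1]/(index_iota 0 n.+1) big_mkord; apply: eq_bigr => s _.
rewrite big_seq1 /inner_term /inner_expo /tail /part -[(2 - 1)%N]/(1%N).
rewrite !big_nat1 !big_geq //= /base_beta.
have -> : (0 + (3 * s ^ 2 + 3 * s) %/ 2 + 2 * 0 = s ^ 2 + 2 * s + 'C(s, 2))%N.
  by rewrite bin2 -divn2; case: (nat_of_ord s) => //= m; lia.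
by rewrite exprD mul1r; ring.
Qed.

Hypothesis q_neq0 : q != 0.
Hypothesis q_nroot : forall n, q ^+ n.+1 != 1.

Definition inner_alpha (k m : nat) : C :=
  q ^+ ((k - 1) * (4 * m ^ 2 + 4 * m)) * base_alpha q m.

Lemma inner_sum_pair k : (2 <= k)%N -> even_bailey_pair q (inner_alpha k) (inner_sum q k).
Proof.
case: k => [|[|j]] // _; elim: j => [|j IH].
  have h : even_bailey_pair q (base_alpha q) (base_beta q).
    by move=> n M nM; apply: base_pair => //; lia.
  move=> n M nM; rewrite inner_sum2 (bailey_step q_neq0 q_nroot h nM).
  by apply: eq_bigr => m _; rewrite /inner_alpha mul1n.
move=> n M nM; rewrite inner_sumS (bailey_step q_neq0 q_nroot IH nM).
apply: eq_bigr => m _; rewrite /inner_alpha.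
have -> : ((j.+3 - 1) * (4 * m ^ 2 + 4 * m) = (4 * m ^ 2 + 4 * m) +
  (j.+2 - 1) * (4 * m ^ 2 + 4 * m))%N by rewrite !subn1 /=; lia.
by rewrite [in RHS]exprD !mulrA.
Qed.

End InnerSum.

(** * Geometrically dominated series *)

Definition geo_dominated (C : numFieldType) (q : C) (u : nat -> C) (K : C) : Prop :=
  forall n, `|u n| <= K * `|q| ^+ n.

(** The only completeness used by the analysis, kept as a hypothesis so that the argument runs over
    a generic [numFieldType]; [complex_geo_complete] supplies it for [R[i]]. *)
Definition geo_complete (C : numFieldType) (q : C) : Prop :=
  forall (u : nat -> C) (K : C), geo_dominated q u K -> series_cvg u.

Definition psum (C : numFieldType) (u : nat -> C) (n : nat) : C := \sum_(i < n) u i.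

Section Series.
Variables (C : numFieldType) (q : C).
Hypothesis q_lt1 : `|q| < 1.
Hypothesis q_complete : geo_complete q.
Local Notation rho := (`|q|).

Let one_sub_gt0 : 0 < 1 - rho. Proof. by rewrite subr_gt0. Qed.

Lemma cvgC_limn (u : nat -> C) (l : C) : u @ \oo --> l -> limn u = l.
Proof. by move=> h; apply: cvg_lim. Qed.

(** A [numFieldType] may be non-archimedean, so [|q| < 1] alone does not give q^n -> 0. The limit
    comes from the convergence of the geometric series. *)
Lemma cvg_geo0 (K : C) : (fun n => K * rho ^+ n) @ \oo --> (0 : C).
Proof.
have h : (fun n => q ^+ n) @ \oo --> (0 : C).
  apply: cvg_series_cvg_0; apply: (q_complete (K := 1)) => n.
  by rewrite normrX mul1r.
have h2 : (fun n => `|q ^+ n|) @ \oo --> (`|0 : C| : C) by exact: (cvg_norm h).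
rewrite normr0 in h2.
have -> : (fun n => K * rho ^+ n) = (fun n => K * `|q ^+ n|).
  by apply/funext => n; rewrite normrX.
by rewrite -(mulr0 K); exact: (cvgM (cvg_cst K) h2).
Qed.

Lemma geo_small (K e : C) : 0 < e -> exists N, forall n, (N <= n)%N -> `|K| * rho ^+ n <= e.
Proof.
move=> e0; have /cvgrPdist_le /(_ _ e0) [N _ h] := cvg_geo0 `|K|.
by exists N => n /h /=; rewrite sub0r normrN ger0_norm //.
Qed.

Lemma cvg_geo_bound (u : nat -> C) (l K : C) :
  (forall n, `|u n - l| <= K * rho ^+ n) -> u @ \oo --> l.
Proof.
move=> h; apply/cvgrPdist_le => e e0; have [N hN] := geo_small K e0.
exists N => // n /hN /= {}hN; rewrite distrC.
have K0 : 0 <= K by have := le_trans (normr_ge0 _) (h 0%N); rewrite expr0 mulr1.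
by apply: le_trans (h n) _; rewrite -(ger0_norm K0).
Qed.

Lemma cvg_norm_le (u : nat -> C) (l B : C) :
  u @ \oo --> l -> (forall n, `|u n| <= B) -> `|l| <= B.
Proof.
move=> h hB; apply/ler_addgt0Pr => e e0.
have /cvgrPdist_le /(_ _ e0) [N _ /(_ N (leqnn N)) /= hN] := h.
rewrite -[l](subrK (u N)); apply: le_trans (ler_normD _ _) _.
by rewrite addrC lerD.
Qed.

Lemma seriesE (u : nat -> C) : series u = psum u.
Proof. by apply/funext => n; rewrite /series /= big_mkord. Qed.

Lemma psumS (u : nat -> C) n : psum u n.+1 = psum u n + u n.
Proof. by rewrite /psum big_ord_recr. Qed.

Lemma psum0 (u : nat -> C) : psum u 0 = 0.
Proof. by rewrite /psum big_ord0. Qed.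

Lemma geo_cvg (u : nat -> C) K : geo_dominated q u K ->
  psum u @ \oo --> series_sum u.
Proof. by move=> /q_complete; rewrite /series_sum -seriesE. Qed.

Lemma geo_dominated_ge0 (u : nat -> C) K : geo_dominated q u K -> 0 <= K.
Proof. by move=> /(_ 0%N); rewrite expr0 mulr1; apply: le_trans. Qed.

Lemma geo_partial (u : nat -> C) K N m : geo_dominated q u K ->
  `|psum u (N + m) - psum u N| <= K * (rho ^+ N - rho ^+ (N + m)) / (1 - rho).
Proof.
move=> h; elim: m => [|m IH]; first by rewrite addn0 !subrr mulr0 mul0r normr0.
rewrite addnS psumS addrAC; apply: le_trans (ler_normD _ _) _.
apply: le_trans (lerD IH (h _)) _; rewrite le_eqVlt; apply/orP; left; apply/eqP.
by rewrite exprS; field; rewrite gt_eqF.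
Qed.

Lemma geo_tail (u : nat -> C) K N : geo_dominated q u K ->
  `|series_sum u - psum u N| <= K * rho ^+ N / (1 - rho).
Proof.
move=> h; apply: (@cvg_norm_le (fun m => psum u (m + N)%N - psum u N)).
  apply: cvgB; last exact: cvg_cst.
  by rewrite (cvg_shiftn N (psum u)); exact: geo_cvg h.
move=> m; rewrite addnC; apply: le_trans (geo_partial _ _ h) _.
have K0 := geo_dominated_ge0 h.
by rewrite ler_pM2r ?invr_gt0 // ler_wpM2l // gerBl exprn_ge0.
Qed.

Lemma geo_sum_le (u : nat -> C) K : geo_dominated q u K ->
  `|series_sum u| <= K / (1 - rho).
Proof. by move=> /(geo_tail 0); rewrite psum0 subr0 expr0 mulr1. Qed.

Lemma series_sumE (u : nat -> C) l : psum u @ \oo --> l -> series_sum u = l.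
Proof. by rewrite -seriesE; exact: cvgC_limn. Qed.

Lemma geo_sumZ (u : nat -> C) K c : geo_dominated q u K ->
  series_sum (fun n => c * u n) = c * series_sum u.
Proof.
move=> h; apply: series_sumE.
have -> : psum (fun n => c * u n) = (fun n => c * psum u n).
  by apply/funext => n; rewrite /psum mulr_sumr.
exact: (cvgM (cvg_cst c) (geo_cvg h)).
Qed.

Lemma geo_sumD (u v : nat -> C) K L : geo_dominated q u K -> geo_dominated q v L ->
  series_sum (fun n => u n + v n) = series_sum u + series_sum v.
Proof.
move=> h1 h2; apply: series_sumE.
have -> : psum (fun n => u n + v n) = (fun n => psum u n + psum v n).
  by apply/funext => n; rewrite /psum big_split.
exact: (cvgD (geo_cvg h1) (geo_cvg h2)).
Qed.

Lemma telescope_sum (u g : nat -> C) l : (forall n, u n = g n.+1 - g n) ->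
  g @ \oo --> l -> series_sum u = l - g 0%N.
Proof.
move=> h hg; apply: series_sumE.
have -> : psum u = (fun n => g n - g 0%N).
  by apply/funext => n; rewrite /psum (eq_bigr _ (fun (i : 'I_n) _ => h i))
    -(big_mkord xpredT (fun i => g i.+1 - g i)) telescope_sumr.
exact: (cvgB hg (cvg_cst _)).
Qed.

(** Dominated convergence by e/3: one M makes the tails of [g] and of every [f N] small, and the
    heads of length M converge termwise. *)
Lemma tannery (f : nat -> nat -> C) (g : nat -> C) (K : C) :
  (forall N, geo_dominated q (f N) K) -> (forall n, (fun N => f N n) @ \oo --> g n) ->
  (fun N => series_sum (f N)) @ \oo --> series_sum g.
Proof.
move=> hf hg.
have hgK : geo_dominated q g K by move=> n; apply: (cvg_norm_le (hg n)) => N; exact: hf.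
have hs M : (fun N => psum (f N) M) @ \oo --> psum g M.
  elim: M => [|M IH].
    have -> : (fun N => psum (f N) 0) = (fun=> 0) by apply/funext => N; rewrite psum0.
    by rewrite psum0; exact: cvg_cst.
  have -> : (fun N => psum (f N) M.+1) = (fun N => psum (f N) M + f N M).
    by apply/funext => N; rewrite psumS.
  rewrite psumS; exact: (cvgD IH (hg M)).
have K0 := geo_dominated_ge0 hgK.
apply/cvgrPdist_le => e e0.
have e3 : 0 < e / 3 by rewrite divr_gt0.
have [M hM] := geo_small (K / (1 - rho)) e3.
have {}hM : K * rho ^+ M / (1 - rho) <= e / 3.
  have := hM M (leqnn M); rewrite ger0_norm; last by rewrite divr_ge0 // ltW.
  by rewrite [K / _ * _]mulrAC.
have /cvgrPdist_le /(_ _ e3) [N0 _ hN] := hs M.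
exists N0 => // N /hN /= {}hN.
have -> : series_sum g - series_sum (f N) = (series_sum g - psum g M) +
   (psum g M - psum (f N) M) - (series_sum (f N) - psum (f N) M) by ring.
apply: le_trans (ler_normB _ _) _.
have -> : e = e / 3 + e / 3 + e / 3 by field.
apply: lerD; last exact: le_trans (geo_tail M (hf N)) hM.
apply: le_trans (ler_normD _ _) _; apply: lerD => //.
exact: le_trans (geo_tail M hgK) hM.
Qed.

(** * Summing a triangular array by columns *)

Section Triangle.
Variables (g : nat -> nat -> C) (K : C).
Hypothesis g_le : forall m s, `|g m s| <= K * rho ^+ (3 * m) * rho ^+ s.

Let g_dom m : geo_dominated q (g m) (K * rho ^+ (3 * m)).
Proof. by move=> s; exact: g_le. Qed.

Let K_ge0 : 0 <= K.
Proof. by have := geo_dominated_ge0 (g_dom 0%N); rewrite muln0 expr0 mulr1. Qed.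

Lemma column_sum_dominated :
  geo_dominated q (fun m => series_sum (g m)) (K / (1 - rho)).
Proof.
move=> m; apply: le_trans (geo_sum_le (g_dom m)) _.
rewrite mulrAC; apply: ler_wpM2l; first by rewrite divr_ge0 // ltW.
by apply: ler_wiXn2l; rewrite ?normr_ge0 ?(ltW q_lt1) //; lia.
Qed.

(** Going from N to N + 1 adds one entry to each column with 2 m <= N; truncated subtraction keeps
    the other columns empty. *)
Lemma psum_triangle N :
  psum (fun n => \sum_(0 <= m < (n %/ 2).+1) g m (n - 2 * m)) N
  = \sum_(m < N) psum (g m) (N - 2 * m).
Proof.
elim: N => [|N IH]; first by rewrite psum0 big_ord0.
have step m : psum (g m) (N.+1 - 2 * m) =
    psum (g m) (N - 2 * m) + (if (2 * m <= N)%N then g m (N - 2 * m)%N else 0).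
  case: leqP => h; first by rewrite subSn // psumS.
  by rewrite addr0; congr psum; lia.
rewrite psumS IH (eq_bigr _ (fun (m : 'I_N.+1) _ => step m)) big_split /=.
rewrite big_ord_recr /= (_ : N - 2 * N = 0)%N; last by lia.
rewrite psum0 addr0; congr (_ + _).
rewrite big_mkord (big_ord_widen N.+1 (fun m => g m (N - 2 * m)%N)); last by lia.
by rewrite big_mkcond /=; apply: eq_bigr => m _; congr (if _ then _ else _); lia.
Qed.

(** Column m is cut at N - 2 m, which costs a tail of order rho^(3m) rho^(N-2m), at most rho^(N+m).
    The exponent 3 m in [g_le] is chosen so that these errors add up to O(rho^N). *)
Lemma triangle_cvg :
  psum (fun n => \sum_(0 <= m < (n %/ 2).+1) g m (n - 2 * m)) @ \oo -->
  series_sum (fun m => series_sum (g m)).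
Proof.
have h : (fun N => psum (fun n => \sum_(0 <= m < (n %/ 2).+1) g m (n - 2 * m)) N
    - psum (fun m => series_sum (g m)) N) @ \oo --> (0 : C).
  apply: (@cvg_geo_bound _ _ (K / (1 - rho) / (1 - rho))) => N.
  rewrite subr0 psum_triangle /psum -sumrB.
  apply: le_trans (ler_norm_sum _ _ _) _.
  apply: (@le_trans _ _ (\sum_(m < N) K / (1 - rho) * rho ^+ N * rho ^+ m)).
    apply: ler_sum => m _; rewrite distrC; apply: le_trans (geo_tail _ (g_dom m)) _.
    rewrite (_ : K * _ * _ / _ = K / (1 - rho) * rho ^+ (3 * m + (N - 2 * m))); last first.
      by rewrite exprD; ring.
    rewrite -[leRHS]mulrA -exprD; apply: ler_wpM2l; first by rewrite divr_ge0 // ltW.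
    by apply: ler_wiXn2l; rewrite ?normr_ge0 ?(ltW q_lt1) //; lia.
  rewrite -mulr_sumr (_ : _ / _ / _ * _ = K / (1 - rho) * rho ^+ N * (1 - rho)^-1); last by ring.
  apply: ler_wpM2l; first by rewrite !mulr_ge0 ?exprn_ge0 // invr_ge0 ltW.
  rewrite -[leRHS]mul1r ler_pdivlMr // -[leLHS]opprK -mulrN opprB mulrC -subrX1 opprB.
  by rewrite gerBl exprn_ge0.
set T := psum _ in h *; set G := psum _ in h *.
have -> : T = (fun N => (T N - G N) + G N) by apply/funext => N; rewrite subrK.
rewrite -[series_sum _]add0r; exact: (cvgD h (geo_cvg column_sum_dominated)).
Qed.

End Triangle.

End Series.

(** * Infinite products *)

Lemma cvgC_addl (C : numFieldType) (a : C) (u : nat -> C) (l : C) :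
  u @ \oo --> l -> (fun n => a + u n) @ \oo --> a + l.
Proof. by move=> h; exact: (cvgD (cvg_cst a) h). Qed.

Lemma cvgC_mull (C : numFieldType) (a : C) (u : nat -> C) (l : C) :
  u @ \oo --> l -> (fun n => a * u n) @ \oo --> a * l.
Proof. by move=> h; exact: (cvgM (cvg_cst a) h). Qed.

Section Products.
Variables (C : numFieldType) (q : C).
Hypothesis q_lt1 : `|q| < 1.
Hypothesis q_complete : geo_complete q.
Local Notation rho := (`|q|).

Let one_sub_gt0 : 0 < 1 - rho. Proof. by rewrite subr_gt0. Qed.
Let rhoX_ge0 n : 0 <= rho ^+ n. Proof. exact: exprn_ge0. Qed.
Let rhoX_le1 n : rho ^+ n <= 1. Proof. by apply: exprn_ile1; rewrite ?normr_ge0 ?(ltW q_lt1). Qed.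

(** The sharper bound 2 - rho^n makes the induction close: its increment rho^n (1 - rho) absorbs the
    growth from the new factor when 2 x <= 1 - rho. *)
Lemma qpoch_upper (x : C) n : 0 <= x -> 2 * x <= 1 - rho -> qpoch (- x) rho n <= 2 - rho ^+ n.
Proof.
move=> x0 hx; elim: n => [|n IH]; first by rewrite qpoch0 expr0 (_ : 2 - 1 = 1 :> C) //; ring.
rewrite qpochS mulNr opprK; have h0 : 0 <= 1 + x * rho ^+ n by rewrite addr_ge0 // mulr_ge0.
apply: le_trans (ler_wpM2r h0 IH) _; rewrite -subr_ge0.
have -> : 2 - rho ^+ n.+1 - (2 - rho ^+ n) * (1 + x * rho ^+ n) =
  rho ^+ n * (1 - rho - 2 * x) + x * (rho ^+ n * rho ^+ n) by rewrite exprS; ring.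
by rewrite addr_ge0 ?mulr_ge0 ?subr_ge0.
Qed.

Lemma qpoch_lower (x : C) n : 0 <= x -> 2 * x <= 1 - rho -> (1 + rho ^+ n) / 2 <= qpoch x rho n.
Proof.
move=> x0 hx; elim: n => [|n IH]; first by rewrite qpoch0 expr0 divff // pnatr_eq0.
rewrite qpochS; have h0 : 0 <= 1 - x * rho ^+ n.
  rewrite subr_ge0; apply: le_trans (ler_wpM2l x0 (rhoX_le1 n)) _; rewrite mulr1.
  apply: (@le_trans _ _ (2 * x)); first by rewrite mulr_natl mulr2n lerDl.
  by apply: le_trans hx _; rewrite gerBl.
apply: le_trans _ (ler_wpM2r h0 IH); rewrite -subr_ge0.
have -> : (1 + rho ^+ n) / 2 * (1 - x * rho ^+ n) - (1 + rho ^+ n.+1) / 2 =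
  rho ^+ n / 2 * (1 - rho - 2 * x) + x * rho ^+ n / 2 * (1 - rho ^+ n).
  by rewrite exprS; field.
by rewrite addr_ge0 // !mulr_ge0 ?invr_ge0 ?subr_ge0 // mulr_ge0.
Qed.

Lemma qpoch_norm_le (a x : C) n : `|a| <= x -> `|qpoch a q n| <= qpoch (- x) rho n.
Proof.
move=> ax; rewrite /qpoch normr_prod; apply: ler_prod => i _; rewrite normr_ge0 /=.
apply: le_trans (ler_normB _ _) _; rewrite normr1 mulNr opprK lerD2l normrM normrX.
exact: ler_wpM2r.
Qed.

Lemma qpoch_norm_ge (a : C) n : 2 * `|a| <= 1 - rho -> qpoch `|a| rho n <= `|qpoch a q n|.
Proof.
move=> ha; rewrite /qpoch normr_prod; apply: ler_prod => i _; apply/andP; split.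
  rewrite subr_ge0; apply: le_trans (ler_wpM2l (normr_ge0 a) (rhoX_le1 i)) _; rewrite mulr1.
  apply: (@le_trans _ _ (2 * `|a|)); first by rewrite mulr_natl mulr2n lerDl.
  by apply: le_trans ha _; rewrite gerBl.
by apply: le_trans _ (lerB_dist _ _); rewrite normr1 normrM normrX.
Qed.

Lemma small_shift (x : C) : 0 <= x -> exists N, 2 * (x * rho ^+ N) <= 1 - rho.
Proof.
move=> x0; have [N /(_ N (leqnn N))] := geo_small q_complete (2 * x) one_sub_gt0.
by rewrite ger0_norm ?mulr_ge0 // -mulrA => h; exists N.
Qed.

(** After N factors the base x rho^N is small enough for [qpoch_upper], which bounds the remaining
    product by 2. The bound is uniform in a, as [tannery] later requires. *)
Lemma qpoch_bounded (x : C) : 0 <= x ->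
  exists2 K : C, 0 <= K & forall (a : C) n, `|a| <= x -> `|qpoch a q n| <= K.
Proof.
move=> x0; have [N hN] := small_shift x0.
have qn0 y n : 0 <= y -> 0 <= qpoch (- y) rho n.
  move=> y0; rewrite /qpoch; apply: prodr_ge0 => i _.
  by rewrite mulNr opprK addr_ge0 // mulr_ge0.
have mono n m : qpoch (- x) rho n <= qpoch (- x) rho (n + m).
  elim: m => [|m IH]; first by rewrite addn0.
  rewrite addnS qpochS; apply: le_trans IH _; rewrite mulNr opprK.
  by rewrite ler_peMr ?qn0 // lerDl mulr_ge0.
exists (qpoch (- x) rho N * 2) => [|a n ax]; first by rewrite mulr_ge0 // qn0.
apply: le_trans (qpoch_norm_le n ax) _; apply: le_trans (mono n N) _.
rewrite addnC qpochD mulNr; apply: ler_wpM2l; first exact: qn0.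
apply: le_trans (qpoch_upper _ _ hN) _; first by rewrite mulr_ge0.
by rewrite gerBl.
Qed.

(** The increments of (a; q)_n: they turn the infinite product into a geometrically dominated
    series. Their bound carries a factor |a|, which gives [qpochoo_sub1]. *)
Let qdiff (a : C) (i : nat) : C := - (a * q ^+ i * qpoch a q i).

Let qdiff_psum (a : C) : (fun n => 1 + psum (qdiff a) n) = qpoch a q.
Proof.
apply/funext; elim=> [|n IH]; first by rewrite qpoch0 psum0 addr0.
by rewrite qpochS psumS addrA IH /qdiff; ring.
Qed.

Let qdiff_dominated (x K : C) : (forall a n, `|a| <= x -> `|qpoch a q n| <= K) ->
  forall a : C, `|a| <= x -> geo_dominated q (qdiff a) (K * `|a|).
Proof.
move=> hK a ax n; rewrite normrN !normrM normrX mulrC mulrA ler_wpM2r // ler_wpM2r //.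
exact: hK.
Qed.

Let qpoch_cvg_qdiff (a K : C) : geo_dominated q (qdiff a) K ->
  qpoch a q @ \oo --> 1 + series_sum (qdiff a).
Proof.
by move=> /(geo_cvg q_complete) h; have h2 := cvgC_addl (a := 1) h; rewrite qdiff_psum in h2.
Qed.

Lemma qpoch_cvg (a : C) : qpoch a q @ \oo --> qpochoo a q.
Proof.
have [K _ hK] := qpoch_bounded (normr_ge0 a).
have h := qpoch_cvg_qdiff (qdiff_dominated hK (lexx _)).
by rewrite /qpochoo (cvgC_limn h).
Qed.

Lemma qpochoo_sub1 (x : C) : 0 <= x ->
  exists K : C, forall a : C, `|a| <= x -> `|qpochoo a q - 1| <= K * `|a|.
Proof.
move=> x0; have [K _ hK] := qpoch_bounded x0; exists (K / (1 - rho)) => a ax.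
have h := qdiff_dominated hK ax.
rewrite /qpochoo (cvgC_limn (qpoch_cvg_qdiff h)) addrC addrA addNr add0r mulrAC.
exact: geo_sum_le h.
Qed.

Lemma qpochoo_bounded (x : C) : 0 <= x ->
  exists2 K : C, 0 <= K & forall a : C, `|a| <= x -> `|qpochoo a q| <= K.
Proof.
move=> x0; have [K K0 hK] := qpoch_bounded x0; exists K => // a ax.
by apply: (cvg_norm_le (@qpoch_cvg a)) => n; exact: hK.
Qed.

Lemma qpochooSl (a : C) : qpochoo a q = (1 - a) * qpochoo (a * q) q.
Proof.
apply: cvgC_limn; rewrite -(cvg_shiftS (qpoch a q)).
rewrite (_ : [sequence _]_n = fun n => (1 - a) * qpoch (a * q) q n).
  exact: (cvgC_mull (a := 1 - a) (@qpoch_cvg _)).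
by apply/funext => n; rewrite /= qpochSl.
Qed.

Lemma qpochoo_split (a : C) n : qpochoo a q = qpoch a q n * qpochoo (a * q ^+ n) q.
Proof.
elim: n => [|n IH]; first by rewrite qpoch0 mul1r expr0 mulr1.
by rewrite IH qpochooSl qpochS exprSr !mulrA.
Qed.

Lemma qpochoo0 : qpochoo 0 q = 1.
Proof.
have [K /(_ 0)] := qpochoo_sub1 (lexx 0).
by rewrite normr0 mulr0 => /(_ (lexx _)); rewrite normr_le0 subr_eq0 => /eqP.
Qed.

Lemma qpochoo1 : qpochoo 1 q = 0.
Proof. by rewrite qpochooSl subrr mul0r. Qed.

Lemma qpochoo_geo_cvg (b : C) : (fun N => qpochoo (b * q ^+ N) q) @ \oo --> (1 : C).
Proof.
have [K hK] := qpochoo_sub1 (normr_ge0 b).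
apply: (cvg_geo_bound q_complete (K := K * `|b|)) => N.
rewrite -mulrA -normrX -normrM; apply: hK.
by rewrite normrM normrX -[leRHS]mulr1 ler_wpM2l.
Qed.

(** For N with a q^N small, |(a; q)_(N+n)| is at least |(a; q)_N| / 2 by [qpoch_lower] and at most K
    |(a; q)_n|, so |(a; q)_n| stays away from 0 for every n. *)
Lemma qpoch_inv_bounded (a : C) : (forall i, a * q ^+ i != 1) ->
  exists2 K : C, 0 <= K & forall n, `|(qpoch a q n)^-1| <= K.
Proof.
move=> ha; have [N hN] := small_shift (normr_ge0 a).
have [K K0 hK] := qpoch_bounded (normr_ge0 a).
have p0 n : 0 < `|qpoch a q n| by rewrite normr_gt0 qpoch_neq0.
exists (K / (`|qpoch a q N| / 2)) => [|n]; first by rewrite divr_ge0 // divr_ge0.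
rewrite normfV ler_pdivlMr ?divr_gt0 // mulrC ler_pdivrMr //.
have -> : K * `|qpoch a q n| = `|qpoch a q n| * K by rewrite mulrC.
apply: (@le_trans _ _ `|qpoch a q (N + n)|).
  rewrite qpochD normrM; apply: ler_wpM2l; first by [].
  have ha2 : 2 * `|a * q ^+ N| <= 1 - rho by rewrite normrM normrX.
  apply: le_trans _ (qpoch_norm_ge _ ha2).
  apply: le_trans _ (qpoch_lower _ _ ha2); last by [].
  by rewrite -[leLHS]mul1r; apply: ler_wpM2r; rewrite ?invr_ge0 // lerDl.
rewrite addnC qpochD normrM; apply: ler_wpM2l; first by [].
by apply: hK; rewrite normrM normrX -[leRHS]mulr1 ler_wpM2l.
Qed.

End Products.

(** * Warnaar's partial theta identity *)

(* The quotient (c / q; q)_(2 n) / (c; q)_n, written without division by (c; q)_n. *)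
Definition warnaar_weight (C : numFieldType) (q c : C) (n : nat) : C :=
  if n is m.+1 then (1 - c / q) * qpoch (c * q ^+ n) q m else 1.

(** The prefactor (q, a, b; q)_oo is multiplied in, with (x; q)_oo / (x; q)_n written as (x q^n;
    q)_oo. Hence there is no denominator in a or b, and a = 0 or b = 0 is allowed. *)
Definition warnaar_term (C : numFieldType) (q a b : C) (n : nat) : C :=
  q ^+ n * warnaar_weight q (a * b) n
  * (qpochoo (q ^+ n.+1) q * qpochoo (a * q ^+ n) q * qpochoo (b * q ^+ n) q).

Definition partial_theta_term (C : numFieldType) (q a : C) (n : nat) : C :=
  (-1) ^+ n * a ^+ n * q ^+ 'C(n, 2).

Lemma cvgC_mul1 (C : numFieldType) (u v : nat -> C) :
  u @ \oo --> (1 : C) -> v @ \oo --> (1 : C) -> (fun n => u n * v n) @ \oo --> (1 : C).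
Proof.
move=> hu hv; have h : (fun n => u n * v n) @ \oo --> (1 * 1 : C) by exact: (cvgM hu hv).
by rewrite mulr1 in h.
Qed.

Lemma const_diff_lim (C : numFieldType) (u v : nat -> C) (c l m : C) :
  (forall n, c = u n - v n) -> u @ \oo --> l -> v @ \oo --> m -> c = l - m.
Proof.
move=> e hu hv; have h : (fun n => u n - v n) @ \oo --> (l - m : C) by exact: (cvgB hu hv).
have e2 : (fun n => u n - v n) = (fun=> c) by apply/funext => n; rewrite -e.
by rewrite -(cvgC_limn h) e2; apply/esym/cvgC_limn; exact: cvg_cst.
Qed.

Section Warnaar.
Variables (C : numFieldType) (q : C).
Hypothesis q_lt1 : `|q| < 1.
Hypothesis q_neq0 : q != 0.
Hypothesis q_complete : geo_complete q.
Local Notation rho := (`|q|).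
Local Notation w := (warnaar_weight q).
Local Notation t := (warnaar_term q).

Let one_sub_gt0 : 0 < 1 - rho. Proof. by rewrite subr_gt0. Qed.
Let rhoX_ge0 n : 0 <= rho ^+ n. Proof. exact: exprn_ge0. Qed.
Let rhoX_le1 n : rho ^+ n <= 1. Proof. by apply: exprn_ile1; rewrite ?normr_ge0 ?(ltW q_lt1). Qed.
Let mulX_le (a : C) n : `|a * q ^+ n| <= `|a|.
Proof. by rewrite normrM normrX -[leRHS]mulr1 ler_wpM2l. Qed.

(** This and [weight_shift] are the ratios of the weight under n -> n + 1 and c -> c q, in
    cross-multiplied form; they express all weights of the mixed difference through
    [w (a * b) n]. *)
Lemma weightS c n :
  w c n.+1 * (1 - c * q ^+ n) = w c n * (1 - c * (q ^+ n * q ^+ n) / q) * (1 - c * (q ^+ n * q ^+ n)).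
Proof.
case: n => [|m]; first by rewrite /= qpoch0 expr0 !mulr1 mul1r.
rewrite /warnaar_weight -!mulrA; congr (_ * _).
have -> : qpoch (c * q ^+ m.+2) q m.+1 * (1 - c * q ^+ m.+1) = qpoch (c * q ^+ m.+1) q m.+2.
  by rewrite [RHS]qpochSl mulrC -mulrA -exprSr.
rewrite !qpochS.
by rewrite !exprS; field.
Qed.

Lemma weight_shift c n :
  w (c * q) n * (1 - c / q) * (1 - c * q ^+ n) = w c n * (1 - c * (q ^+ n * q ^+ n) / q) * (1 - c).
Proof.
case: n => [|m]; first by rewrite /= expr0 !mulr1 !mul1r.
rewrite /warnaar_weight mulfK //.
have e : qpoch (c * q * q ^+ m.+1) q m * (1 - c * q ^+ m.+1) =
    qpoch (c * q ^+ m.+1) q m * (1 - c * q ^+ m.+1 * q ^+ m).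
  by rewrite -qpochS qpochSl mulrC (mulrAC c q).
have -> : 1 - c * (q ^+ m.+1 * q ^+ m.+1) / q = 1 - c * q ^+ m.+1 * q ^+ m.
  by rewrite !exprS; field.
transitivity ((1 - c) * (1 - c / q) * (qpoch (c * q * q ^+ m.+1) q m * (1 - c * q ^+ m.+1))).
  by ring.
by rewrite e; ring.
Qed.

Lemma weight0 n : w 0 n = 1.
Proof.
case: n => // m; rewrite /= !mul0r subr0 mul1r /qpoch big1 // => i _.
by rewrite mul0r subr0.
Qed.

Lemma weight_bounded (x : C) : 0 <= x ->
  exists2 K : C, 0 <= K & forall c n, `|c| <= x -> `|w c n| <= K.
Proof.
move=> x0; have [K K0 hK] := qpoch_bounded q_lt1 q_complete x0.
exists (1 + (1 + x / rho) * K) => [|c [|m] cx].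
- by rewrite addr_ge0 // mulr_ge0 // addr_ge0 // divr_ge0.
- by rewrite normr1 lerDl mulr_ge0 // addr_ge0 // divr_ge0.
rewrite normrM -[leLHS]add0r; apply: lerD => //; apply: ler_pM => //.
  apply: le_trans (ler_normB _ _) _; rewrite normr1 lerD2l normf_div.
  by apply: ler_wpM2r => //; rewrite invr_ge0.
by apply: hK; apply: le_trans (mulX_le _ _) cx.
Qed.

Lemma warnaar_dominated (x : C) : 0 <= x ->
  exists K : C, forall a b : C, `|a| <= x -> `|b| <= x -> geo_dominated q (t a b) K.
Proof.
move=> x0; have [K K0 hK] := weight_bounded (mulr_ge0 x0 x0).
have [L L0 hL] := qpochoo_bounded q_lt1 q_complete x0.
have [L1 L10 hL1] := qpochoo_bounded q_lt1 q_complete (@ler01 C).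
exists (K * (L1 * L * L)) => a b ax bx n.
rewrite /warnaar_term !normrM normrX mulrC -mulrA.
rewrite [rho ^+ n * _]mulrC mulrA; apply: ler_wpM2r => //.
have Lq : `|qpochoo (q ^+ n.+1) q| <= L1 by apply: hL1; rewrite normrX.
have La : `|qpochoo (a * q ^+ n) q| <= L by apply: hL; apply: le_trans (mulX_le _ _) ax.
have Lb : `|qpochoo (b * q ^+ n) q| <= L by apply: hL; apply: le_trans (mulX_le _ _) bx.
have Lw : `|w (a * b) n| <= K by apply: hK; rewrite normrM; exact: ler_pM.
by rewrite [leRHS]mulrC -[L1 * _ * _]mulrA !ler_pM ?mulr_ge0.
Qed.

Lemma warnaar_termC (a b : C) : t a b = t b a.
Proof. by apply/funext => n; rewrite /warnaar_term [b * a]mulrC; ring. Qed.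

(** An antidifference in n of the mixed difference. It is 0 at n = 0 because (1; q)_oo = 0, and its
    factor q^n sends it to 0 at infinity. *)
Let cert (a b : C) n : C :=
  qpochoo (q ^+ n) q * qpochoo (a * q ^+ n) q * qpochoo (b * q ^+ n) q * w (a * b) n
  * (a * b / q) * q ^+ n * (1 - q + (1 - a * b) * q ^+ n)
  / ((1 - a * b / q) * (1 - a * b * q ^+ n)).

(** * Vanishing of the mixed difference *)

Section Mixed.
Variables a b : C.
Hypothesis ab_lt : `|a * b| < rho.

Let c_lt1 : `|a * b / q| < 1.
Proof. by rewrite normf_div ltr_pdivrMr ?normr_gt0 // mul1r. Qed.

Let sub_neq0 (y : C) : `|y| <= `|a * b / q| -> 1 - y != 0.
Proof.
move=> h; rewrite subr_eq0 eq_sym; apply: contraTneq (le_lt_trans h c_lt1) => ->.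
by rewrite normr1 ltxx.
Qed.

(** Bounds the reciprocals of both denominators of [cert] uniformly in n; |a b| < |q| keeps them
    away from 0. *)
Let inv_le (y : C) : `|y| <= `|a * b / q| -> `|(1 - y)^-1| <= (1 - `|a * b / q|)^-1.
Proof.
move=> h; have h0 := sub_neq0 h.
rewrite normfV lef_pV2 ?posrE ?normr_gt0 // ?subr_gt0 //.
apply: le_trans _ (lerB_dist _ _); rewrite normr1 lerD2l lerN2 //.
Qed.

Let bound1 n : `|a * b * q ^+ n| <= `|a * b / q|.
Proof.
apply: le_trans (mulX_le _ _) _; rewrite normf_div ler_pdivlMr ?normr_gt0 //.
by rewrite -[leRHS]mulr1 ler_wpM2l // ltW.
Qed.

Let cert_cvg : cert a b @ \oo --> (0 : C).
Proof.
have [L L0 hL] := qpochoo_bounded q_lt1 q_complete (@ler01 C).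
have [La La0 hLa] := qpochoo_bounded q_lt1 q_complete (normr_ge0 a).
have [Lb Lb0 hLb] := qpochoo_bounded q_lt1 q_complete (normr_ge0 b).
have [K K0 hK] := weight_bounded (normr_ge0 (a * b)).
set M := (1 - `|a * b / q|)^-1.
apply: (cvg_geo_bound q_complete (K := L * La * Lb * K * `|a * b / q| *
  (`|1 - q| + `|1 - a * b|) * (M * M))) => n.
have -> : cert a b n - 0 = qpochoo (q ^+ n) q * qpochoo (a * q ^+ n) q * qpochoo (b * q ^+ n) q
    * w (a * b) n * (a * b / q) * (1 - q + (1 - a * b) * q ^+ n)
    * ((1 - a * b / q)^-1 * (1 - a * b * q ^+ n)^-1)
    * q ^+ n by rewrite subr0 /cert !invfM; ring.
rewrite [`|_ * q ^+ n|]normrM normrX; apply: ler_wpM2r => //.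
have h1 : `|1 - q + (1 - a * b) * q ^+ n| <= `|1 - q| + `|1 - a * b|.
  by apply: le_trans (ler_normD _ _) _; rewrite lerD2l; exact: mulX_le.
have M0 : 0 <= M by rewrite invr_ge0 subr_ge0 ltW.
have k1 : `|qpochoo (q ^+ n) q| <= L by apply: hL; rewrite normrX.
have k2 : `|qpochoo (a * q ^+ n) q| <= La by apply: hLa; exact: mulX_le.
have k3 : `|qpochoo (b * q ^+ n) q| <= Lb by apply: hLb; exact: mulX_le.
have k4 : `|w (a * b) n| <= K by exact: hK.
have i1 := inv_le (lexx _); have i2 := inv_le (bound1 n).
by rewrite ![`|_ * _|]normrM !ler_pM ?mulr_ge0 // -!normrM.
Qed.

(** One factor is peeled from each infinite product at n, so that all terms share the products at n
    + 1; the weights reduce to [w (a * b) n], and a rational identity remains. *)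
Let mixedE n : t a b n - t (a * q) b n - t a (b * q) n + t (a * q) (b * q) n
  = cert a b n.+1 - cert a b n.
Proof.
rewrite /warnaar_term /cert !(mulrAC a q) !(mulrA a b q).
rewrite (mulrAC (a * b) q q) -!(mulrA _ q (q ^+ n)) -!exprS.
rewrite (qpochooSl _ _ (q ^+ n)) // (qpochooSl _ _ (a * q ^+ n)) // (qpochooSl _ _ (b * q ^+ n)) //.
rewrite -!(mulrA _ (q ^+ n) q) -!exprSr.
have h1 : 1 - a * b / q != 0 by exact: sub_neq0.
have h2 := sub_neq0 (bound1 n); have h3 := sub_neq0 (bound1 n.+1).
have h6 := sub_neq0 (bound1 0).
have h1' : q - a * b != 0.
  by have := mulf_neq0 q_neq0 h1; rewrite mulrBr mulr1 mulrCA mulfV // mulr1.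
rewrite expr0 mulr1 in h6.
have e1 : w (a * b) n.+1 = w (a * b) n * (1 - a * b * (q ^+ n * q ^+ n) / q)
    * (1 - a * b * (q ^+ n * q ^+ n)) / (1 - a * b * q ^+ n).
  by rewrite -weightS mulfK.
have e2 : w (a * b * q) n = w (a * b) n * (1 - a * b * (q ^+ n * q ^+ n) / q) * (1 - a * b)
    / (1 - a * b * q ^+ n) / (1 - a * b / q).
  by rewrite -weight_shift !mulfK.
have e3 : w (a * b * q * q) n =
    w (a * b * q) n * (1 - a * b * q * (q ^+ n * q ^+ n) / q) * (1 - a * b * q)
    / (1 - a * b * q * q ^+ n) / (1 - a * b * q / q).
  by rewrite -weight_shift !mulfK // -mulrA -exprS.
rewrite e3 e2 e1; move: h2 h3; rewrite !exprS => h2 h3.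
by field; rewrite q_neq0 h1' h2 h3 h6.
Qed.

Lemma warnaar_mixed_difference :
  series_sum (t a b) - series_sum (t (a * q) b)
  = series_sum (t a (b * q)) - series_sum (t (a * q) (b * q)).
Proof.
have [K hK] := warnaar_dominated (addr_ge0 (normr_ge0 a) (normr_ge0 b)).
have a1 : `|a| <= `|a| + `|b| by rewrite lerDl.
have b1 : `|b| <= `|a| + `|b| by rewrite lerDr.
have a2 : `|a * q| <= `|a| + `|b|.
  by apply: le_trans a1; rewrite -[q]expr1; exact: mulX_le.
have b2 : `|b * q| <= `|a| + `|b|.
  by apply: le_trans b1; rewrite -[q]expr1; exact: mulX_le.
have d1 := hK _ _ a1 b1; have d2 := hK _ _ a2 b1.
have d3 := hK _ _ a1 b2; have d4 := hK _ _ a2 b2.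
apply/eqP; rewrite -subr_eq0; apply/eqP.
have c0 : cert a b 0 = 0 by rewrite /cert expr0 (qpochoo1 q_lt1 q_complete) !mul0r.
rewrite -[RHS](subrr 0) -[X in _ = _ - X]c0 -(telescope_sum mixedE cert_cvg).
have cv1 := geo_cvg q_complete d1; have cv2 := geo_cvg q_complete d2.
have cv3 := geo_cvg q_complete d3; have cv4 := geo_cvg q_complete d4.
apply/esym/series_sumE.
have -> : psum (fun n => t a b n - t (a * q) b n - t a (b * q) n + t (a * q) (b * q) n) =
  (fun n => psum (t a b) n - psum (t (a * q) b) n -
            (psum (t a (b * q)) n - psum (t (a * q) (b * q)) n)).
  by apply/funext => n; rewrite /psum -!sumrB; apply: eq_bigr => i _; ring.
exact: (cvgB (cvgB cv1 cv2) (cvgB cv3 cv4)).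
Qed.

End Mixed.

(** * Limits along b q^N and separation of the variables *)

Lemma qpoch_geo_cvg (c : C) m : (fun N => qpoch (c * q ^+ N) q m) @ \oo --> (1 : C).
Proof.
elim: m => [|m IH].
  have -> : (fun N => qpoch (c * q ^+ N) q 0) = (fun=> 1) by apply/funext => N; rewrite qpoch0.
  exact: cvg_cst.
have -> : (fun N => qpoch (c * q ^+ N) q m.+1) =
  (fun N => qpoch (c * q ^+ N) q m * (1 - c * q ^+ m * q ^+ N)).
  by apply/funext => N; rewrite qpochS; congr (_ * (_ - _)); ring.
apply: (cvgC_mul1 IH).
apply: (cvg_geo_bound q_complete (K := `|c|)) => N.
rewrite addrAC subrr add0r normrN !normrM !normrX mulrAC.
by rewrite -[leRHS]mulr1; apply: ler_wpM2l; rewrite ?mulr_ge0.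
Qed.

Lemma weight_geo_cvg (c : C) n : (fun N => w (c * q ^+ N) n) @ \oo --> (1 : C).
Proof.
case: n => [|m]; first exact: cvg_cst.
have -> : (fun N => w (c * q ^+ N) m.+1) =
  (fun N => qpoch (c / q * q ^+ N) q 1 * qpoch (c * q ^+ m.+1 * q ^+ N) q m).
  apply/funext => N; rewrite /= qpochS qpoch0 mul1r expr0 mulr1.
  by rewrite (mulrAC c) (mulrAC c (q ^+ N)).
exact: (cvgC_mul1 (qpoch_geo_cvg _ _) (qpoch_geo_cvg _ _)).
Qed.

Lemma warnaar_sum_cvg (a b : C) :
  (fun N => series_sum (t a (b * q ^+ N))) @ \oo --> series_sum (t a 0).
Proof.
have [K hK] := warnaar_dominated (addr_ge0 (normr_ge0 a) (normr_ge0 b)).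
apply: (tannery q_lt1 q_complete (K := K)).
  move=> N; apply: hK; first by rewrite lerDl.
  by apply: le_trans (mulX_le _ _) _; rewrite lerDr.
move=> n; rewrite /warnaar_term mulr0 weight0 mul0r (qpochoo0 q_lt1 q_complete).
have -> : (fun N => q ^+ n * w (a * (b * q ^+ N)) n *
    (qpochoo (q ^+ n.+1) q * qpochoo (a * q ^+ n) q * qpochoo (b * q ^+ N * q ^+ n) q)) =
  (fun N => q ^+ n * w (a * b * q ^+ N) n *
    (qpochoo (q ^+ n.+1) q * qpochoo (a * q ^+ n) q * qpochoo (b * q ^+ n * q ^+ N) q)).
  by apply/funext => N; rewrite (mulrA a b) (mulrAC b).
apply: cvgM; first exact: (cvgC_mull (weight_geo_cvg _ _)).
exact: (cvgC_mull (qpochoo_geo_cvg q_lt1 q_complete _)).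
Qed.

Lemma warnaar_split (a b : C) : `|a * b| < rho ->
  series_sum (t a b) = series_sum (t a 0) + series_sum (t b 0) - series_sum (t 0 0).
Proof.
(* The difference in the first argument is invariant under b -> b q, so it equals its limit along b
   q^N, its value at b = 0. *)
have first_diff a' : `|a' * b| < rho -> series_sum (t a' b) - series_sum (t (a' * q) b)
    = series_sum (t a' 0) - series_sum (t (a' * q) 0).
  move=> hab.
  have e N : series_sum (t a' b) - series_sum (t (a' * q) b) =
      series_sum (t a' (b * q ^+ N)) - series_sum (t (a' * q) (b * q ^+ N)).
    elim: N => [|N IH]; first by rewrite expr0 mulr1.
    rewrite IH warnaar_mixed_difference ?exprSr ?mulrA // -mulrA.
    by rewrite mulrA; apply: le_lt_trans (mulX_le _ _) hab.
  exact: (const_diff_lim e (@warnaar_sum_cvg a' b) (@warnaar_sum_cvg (a' * q) b)).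
move=> hab.
(* The same argument in a. Symmetry puts a q^N in the second slot, the one in which
   [warnaar_sum_cvg] takes limits. *)
have e N : series_sum (t a b) - series_sum (t a 0) =
    series_sum (t b (a * q ^+ N)) - series_sum (t 0 (a * q ^+ N)).
  elim: N => [|N IH]; first by rewrite expr0 mulr1 (warnaar_termC b) (warnaar_termC 0).
  have hN : `|a * q ^+ N * b| < rho by rewrite mulrAC; apply: le_lt_trans (mulX_le _ _) hab.
  rewrite IH !(warnaar_termC _ (a * _)) exprSr mulrA.
  have /eqP := first_diff _ hN; rewrite -subr_eq0 => /eqP fd.
  by apply: subr0_eq; rewrite -[RHS]fd; ring.
have h2 := const_diff_lim e (@warnaar_sum_cvg b a) (@warnaar_sum_cvg 0 a).
by rewrite -addrA -h2 addrC subrK.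
Qed.

Lemma warnaar_step (a : C) : series_sum (t a 0) + a * series_sum (t (a * q) 0) = 1.
Proof.
have [K hK] := warnaar_dominated (normr_ge0 a).
have d1 := hK a 0 (lexx _); rewrite normr0 in d1; have {}d1 := d1 (normr_ge0 a).
have d2 : geo_dominated q (t (a * q) 0) K.
  by apply: hK; rewrite ?normr0 // -[X in _ * X]expr1; exact: mulX_le.
(* The telescoping function: [k 0 = 0] because (1; q)_oo = 0, and [k] tends to 1, which is the
   right-hand side. *)
pose k n := qpochoo (1 * q ^+ n) q * qpochoo (a * q ^+ n) q.
have k1 : k @ \oo --> (1 : C).
  exact: (cvgC_mul1 (qpochoo_geo_cvg q_lt1 q_complete _) (qpochoo_geo_cvg q_lt1 q_complete _)).
have kE n : t a 0 n + a * t (a * q) 0 n = k n.+1 - k n.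
  rewrite /warnaar_term /k !mulr0 !weight0 !mul0r (qpochoo0 q_lt1 q_complete) !mul1r.
  rewrite (qpochooSl _ _ (q ^+ n)) // (qpochooSl _ _ (a * q ^+ n)) //.
  rewrite -!(mulrA _ (q ^+ n) q) -(mulrA a q) -exprS -exprSr; ring.
have := telescope_sum kE k1.
rewrite {1}/k expr0 mulr1 (qpochoo1 q_lt1 q_complete) mul0r subr0 => <-.
have d3 : geo_dominated q (fun n => a * t (a * q) 0 n) (`|a| * K).
  by move=> n; rewrite normrM -mulrA ler_wpM2l.
by rewrite (geo_sumD q_complete d1 d3) (geo_sumZ q_complete _ d2).
Qed.

(** The ratio test; each induction step on N peels off one initial term and absorbs it into the
    constant. *)
Lemma eventually_geo_dominated (u : nat -> C) N :
  (forall n, (N <= n)%N -> `|u n.+1| <= rho * `|u n|) -> exists K, geo_dominated q u K.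
Proof.
have r0 : 0 < rho by rewrite normr_gt0.
elim: N u => [|N IH] u hu.
  exists `|u 0%N|; elim=> [|n IHn]; first by rewrite expr0 mulr1.
  by apply: le_trans (hu _ _) _ => //; rewrite exprS mulrCA ler_wpM2l.
have [K hK] := IH (fun n => u n.+1) (fun n hn => hu n.+1 hn).
have K0 := geo_dominated_ge0 hK.
exists (`|u 0%N| + K / rho) => -[|n].
  by rewrite expr0 mulr1 lerDl divr_ge0.
apply: le_trans (hK n) _; rewrite mulrDl exprS -mulrA mulKf ?gt_eqF //.
by rewrite lerDr !mulr_ge0.
Qed.

Lemma partial_theta_dominated (a : C) : exists K, geo_dominated q (partial_theta_term q a) K.
Proof.
have r0 : 0 < rho by rewrite normr_gt0.
have [N hN] := geo_small q_complete a r0.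
apply: (@eventually_geo_dominated _ N) => n /hN {}hN.
have -> : partial_theta_term q a n.+1 = - (a * q ^+ n) * partial_theta_term q a n.
  by rewrite /partial_theta_term binS bin1 exprD !exprS; ring.
by rewrite normrM normrN normrM normrX; apply: ler_wpM2r.
Qed.

Lemma warnaar_theta (a : C) : series_sum (t a 0) = series_sum (partial_theta_term q a).
Proof.
have [K hK] := partial_theta_dominated a.
have [L hL] := warnaar_dominated (normr_ge0 a).
apply/esym/series_sumE.
apply: (cvg_geo_bound q_complete (K := K * (L / (1 - rho)))) => N.
(* The exact remainder after N uses of [warnaar_step]: the series at a q^N stays bounded while the
   theta term decays geometrically. *)
have e : psum (partial_theta_term q a) N - series_sum (t a 0) =
    - (partial_theta_term q a N * series_sum (t (a * q ^+ N) 0)).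
  elim: N => [|N IH].
    by rewrite psum0 sub0r expr0 mulr1 /partial_theta_term bin0n !expr0 !mul1r.
  rewrite psumS addrAC IH.
  have -> : partial_theta_term q a N.+1 = - (a * q ^+ N) * partial_theta_term q a N.
    by rewrite /partial_theta_term binS bin1 exprD !exprS; ring.
  have := warnaar_step (a * q ^+ N); rewrite -(mulrA a (q ^+ N) q) -exprSr => /eqP.
  by rewrite eq_sym -subr_eq => /eqP <-; ring.
rewrite e normrN normrM mulrAC; apply: ler_pM => //.
apply: (geo_sum_le q_lt1 q_complete); apply: hL; first exact: mulX_le.
by rewrite normr0.
Qed.

(** The constant is S(0, 0) = 1, read off from [warnaar_step] at a = 0. *)
Lemma warnaar_identity (a b : C) : `|a * b| < rho ->
  series_sum (t a b)
  = series_sum (partial_theta_term q a) + series_sum (partial_theta_term q b) - 1.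
Proof.
move=> h; rewrite warnaar_split // !warnaar_theta; congr (_ - _).
by rewrite -warnaar_theta; have := warnaar_step 0; rewrite mul0r addr0.
Qed.

End Warnaar.

(** * The identity *)

Lemma bin2_double s : (2 * 'C(s, 2) + s = s * s)%N.
Proof. by elim: s => // s IH; rewrite binS bin1; lia. Qed.

(** After n = 2 m + s, the part depending on s is (2 m + 1) s + s (s - 1) / 2, the exponent of a
    theta term with argument z q^(2m+1). *)
Lemma rhs_expoE m s : rhs_expo (2 * m + s) m = Posz (m * m + m + 2 * m * s + s + 'C(s, 2)).
Proof.
rewrite /rhs_expo.
have -> : (2 * m + s)%N%:Z ^+ 2 - 2 * m%:Z ^+ 2 + (2 * m + s)%N%:Z =
    Posz (m * m + m + 2 * m * s + s + 'C(s, 2)) * 2.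
  have := bin2_double s; rewrite !expr2; lia.
by rewrite mulzK.
Qed.

Section Identity.
Variables (C : numFieldType) (q z : C) (k : nat).
Hypothesis q_neq0 : q != 0.
Hypothesis q_lt1 : `|q| < 1.
Hypothesis z_neq0 : z != 0.
Hypothesis z_neq : forall m : int, m != 0 -> z != q ^ m.
Hypothesis k_ge2 : (2 <= k)%N.
Hypothesis q_complete : geo_complete q.
Local Notation rho := (`|q|).
Local Notation theta := (partial_theta_term q).

Let rho_gt0 : 0 < rho. Proof. by rewrite normr_gt0. Qed.
Let rhoX_ge0 n : 0 <= rho ^+ n. Proof. exact: exprn_ge0. Qed.
Let rhoX_le1 n : rho ^+ n <= 1. Proof. by apply: exprn_ile1; rewrite ?normr_ge0 ?(ltW q_lt1). Qed.
Let rhoX_le m n : (m <= n)%N -> rho ^+ n <= rho ^+ m.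
Proof. by move=> h; apply: ler_wiXn2l; rewrite ?normr_ge0 ?(ltW q_lt1). Qed.

Let q_nroot n : q ^+ n.+1 != 1.
Proof.
apply/negP => /eqP e; have : `|q ^+ n.+1| < 1 by rewrite normrX exprn_ilt1.
by rewrite e normr1 ltxx.
Qed.

Let zq_neq1 i : z * q * q ^+ i != 1.
Proof.
apply/negP => /eqP e; have /negP := z_neq (isT : Negz i != 0); apply; apply/eqP.
have qX : q ^+ i.+1 != 0 by rewrite expf_neq0.
rewrite -[RHS]mul1r -e -mulrA -exprS -[q ^ Negz i]/((q ^+ i.+1)^-1).
by rewrite -mulrA mulfV // mulr1.
Qed.

Let qz_neq1 i : z^-1 * q * q ^+ i != 1.
Proof.
apply/negP => /eqP e; have /negP := z_neq (isT : Posz i.+1 != 0); apply; apply/eqP.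
by rewrite -[LHS]mulr1 -e -mulrA -exprS mulrA mulfV // mul1r.
Qed.

(** Supplies the decay rho^(3m) required by [triangle_cvg]. *)
Let expo_ge m : (3 * m <= (k - 1) * (4 * m ^ 2 + 4 * m))%N.
Proof.
have k1 : (0 < k - 1)%N by lia.
by apply: leq_trans (leq_pmull _ k1); lia.
Qed.

(** The coefficient of column m: (-1)^m and the powers of q from [inner_alpha], together with q^(2m)
    from q^n at n = 2 m + s. *)
Let c (m : nat) : C := (-1) ^+ m * q ^+ (m * m + m + (k - 1) * (4 * m ^ 2 + 4 * m)).

Let c_le m : `|c m| <= rho ^+ (3 * m).
Proof.
rewrite normrM normrX normrN1 expr1n mul1r normrX; apply: rhoX_le.
exact: leq_trans (expo_ge m) (leq_addl _ _).
Qed.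

(** These arguments are what remains of (z q; q)_oo and (z^-1 q; q)_oo after 2 m and 2 m + 1
    factors; the extra factor for z^-1 comes from the index n + 1 in the denominator. *)
Let a (m : nat) : C := z * q ^+ (2 * m).+1.
Let b (m : nat) : C := z^-1 * q ^+ (2 * m).+2.

Let theta_uniform (x : C) :
  exists2 K : C, 0 <= K & forall y : C, `|y| <= `|x| -> geo_dominated q (theta y) K.
Proof.
have [K hK] := partial_theta_dominated q_neq0 q_complete x.
exists K => [|y yx n]; first exact: geo_dominated_ge0 hK.
apply: le_trans (hK n); rewrite /partial_theta_term !normrM ler_wpM2r // ler_wpM2l //.
by rewrite !normrX lerXn2r ?nnegrE.
Qed.

Let a_le m : `|a m| <= `|z|.
Proof. by rewrite normrM normrX -[leRHS]mulr1 ler_wpM2l. Qed.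

Let b_le m : `|b m| <= `|z^-1|.
Proof. by rewrite normrM normrX -[leRHS]mulr1 ler_wpM2l. Qed.

(** * The left side by columns *)

Let lhs_cell (m s : nat) : C :=
  qpoch (q ^+ 2) q (2 * (2 * m + s)) * q ^+ (2 * m + s)
  / (qpoch (z * q) q (2 * m + s) * qpoch (z^-1 * q) q (2 * m + s).+1)
  * (inner_alpha q k m / qpoch q q s / qpoch (q ^+ 3) q (4 * m + s)).

Let lhs_termE n : lhs_term q z k n = \sum_(0 <= m < (n %/ 2).+1) lhs_cell m (n - 2 * m).
Proof.
rewrite /lhs_term (inner_sum_pair q_neq0 q_nroot k_ge2 (ltnSn n)) big_mkord.
rewrite (big_ord_widen n.+1 (fun m => lhs_cell m (n - 2 * m))); last by lia.
rewrite [in RHS]big_mkcond /= mulr_sumr; apply: eq_bigr => m _.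
case: ifP => h; last by rewrite inv_qfact_gt ?mulr0 ?mul0r ?mulr0 //; lia.
have h2 : (2 * m <= n)%N by lia.
rewrite inv_qfact_le // /lhs_cell subnKC //; congr (_ * (_ / qpoch _ _ _)); lia.
Qed.

(** Decay in m comes from [inner_alpha], decay in s from q^(2m+s). The condition on z makes the
    reciprocals of both z-dependent products bounded. *)
Let lhs_cell_le : exists K : C, forall m s, `|lhs_cell m s| <= K * rho ^+ (3 * m) * rho ^+ s.
Proof.
have [K1 K10 h1] := qpoch_bounded q_lt1 q_complete (@ler01 C).
have [K2 K20 h2] := qpoch_inv_bounded q_lt1 q_complete zq_neq1.
have [K3 K30 h3] := qpoch_inv_bounded q_lt1 q_complete qz_neq1.
have e4 i : q * q ^+ i != 1 by rewrite -exprS.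
have [K4 K40 h4] := qpoch_inv_bounded q_lt1 q_complete e4.
have e5 i : q ^+ 3 * q ^+ i != 1 by rewrite -exprD addSn.
have [K5 K50 h5] := qpoch_inv_bounded q_lt1 q_complete e5.
pose A := 2 * `|(1 - q ^+ 2)^-1|.
have A0 : 0 <= A by rewrite mulr_ge0.
have hA m : `|inner_alpha q k m| <= A * rho ^+ (3 * m).
  rewrite /inner_alpha /base_alpha.
  have -> : q ^+ ((k - 1) * (4 * m ^ 2 + 4 * m)) * ((-1) ^+ m * q ^+ (m * m.-1) *
     (1 - q ^+ (4 * m + 2)) / (1 - q ^+ 2)) = ((1 - q ^+ (4 * m + 2)) / (1 - q ^+ 2)) *
     ((-1) ^+ m * q ^+ ((k - 1) * (4 * m ^ 2 + 4 * m) + m * m.-1)).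
    by rewrite (exprD q (_ * _) (_ * _)); ring.
  rewrite 3!normrM normrX normrN1 expr1n mul1r normrX; apply: ler_pM; rewrite ?mulr_ge0 //.
    apply: ler_wpM2r => //; apply: le_trans (ler_normB _ _) _; rewrite normr1 normrX.
    by rewrite [leRHS](_ : 2 = 1 + 1) // lerD2l.
  by apply: rhoX_le; exact: leq_trans (expo_ge m) (leq_addr _ _).
exists (K1 * K2 * K3 * A * K4 * K5) => m s.
have -> : lhs_cell m s = qpoch (q ^+ 2) q (2 * (2 * m + s)) * (qpoch (z * q) q (2 * m + s))^-1
    * (qpoch (z^-1 * q) q (2 * m + s).+1)^-1 * inner_alpha q k m
    * (qpoch q q s)^-1 * (qpoch (q ^+ 3) q (4 * m + s))^-1 * q ^+ (2 * m + s).
  by rewrite /lhs_cell !invfM; ring.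
rewrite [`|_ * q ^+ _|]normrM [`|q ^+ _|]normrX; apply: ler_pM => //; last by apply: rhoX_le; lia.
have -> : K1 * K2 * K3 * A * K4 * K5 * rho ^+ (3 * m) = K1 * K2 * K3 * (A * rho ^+ (3 * m)) * K4 * K5.
  by ring.
have n2 : `|q ^+ 2| <= 1 by rewrite normrX.
have b1 := h1 _ (2 * (2 * m + s))%N n2; have b2 := h2 (2 * m + s)%N; have b3 := h3 (2 * m + s).+1.
have b4 := h4 s; have b5 := h5 (4 * m + s)%N; have b6 := hA m.
move: (inner_alpha q k m) b6 => al b6.
by rewrite ![`|_ * _|]normrM !ler_pM ?mulr_ge0.
Qed.

(** Here a b = q^(4m+3), so a b / q = q^(4m+2): the numerator 1 - q^(4m+2) of [base_alpha] is the
    first factor of the weight for s > 0, and the rest is the end of (q^2; q)_(2n) beyond (q^3;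
    q)_(4m+s). *)
Let weightE m s : qpoch (q ^+ 2) q (2 * (2 * m + s)) * (1 - q ^+ (4 * m + 2))
  = (1 - q ^+ 2) * qpoch (q ^+ 3) q (4 * m + s) * warnaar_weight q (a m * b m) s.
Proof.
have -> : a m * b m = q ^+ (4 * m + 3).
  rewrite /a /b mulrACA mulfV // mul1r -exprD; congr (_ ^+ _); lia.
have q3 : q ^+ 2 * q = q ^+ 3 by rewrite -exprSr.
have e n : qpoch (q ^+ 2) q n.+1 = (1 - q ^+ 2) * qpoch (q ^+ 3) q n by rewrite qpochSl q3.
case: s => [|s] /=.
  rewrite !addn0 mulr1 -e qpochS -exprD; congr (qpoch _ _ _ * (1 - _ ^+ _)); lia.
have -> : (2 * (2 * m + s.+1) = (4 * m + s.+1 + s).+1)%N by lia.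
rewrite e qpochD -!exprD (_ : q ^+ (4 * m + 3) / q = q ^+ (4 * m + 2)); last first.
  by rewrite addnS exprSr mulfK.
by rewrite (_ : 3 + (4 * m + s.+1) = 4 * m + 3 + s.+1)%N; [ring | lia].
Qed.

Local Notation P := (qpochoo (z * q) q * qpochoo (z^-1 * q) q * qpochoo q q).

Let lhs_columnE m s : P * lhs_cell m s = c m * warnaar_term q (a m) (b m) s.
Proof.
have n1 := qpoch_neq0 (2 * m + s) zq_neq1.
have n2 := qpoch_neq0 (2 * m + s).+1 qz_neq1.
have n3 := qpochq_neq0 q_nroot s.
have n4 := qpochX_neq0 q_nroot 2 (4 * m + s).
have n5 : 1 - q ^+ (4 * m + 2) != 0 by rewrite addnS; exact: subX_neq0.
have n6 : 1 - q ^+ 2 != 0 by exact: subX_neq0.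
rewrite (qpochoo_split q_lt1 q_complete (z * q) (2 * m + s)).
rewrite (qpochoo_split q_lt1 q_complete (z^-1 * q) (2 * m + s).+1).
rewrite (qpochoo_split q_lt1 q_complete q s) -exprS.
have -> : z * q * q ^+ (2 * m + s) = a m * q ^+ s.
  by rewrite /a (exprS q (2 * m)) exprD; ring.
have -> : z^-1 * q * q ^+ (2 * m + s).+1 = b m * q ^+ s.
  by rewrite /b (exprS q (2 * m).+1) (exprS q (2 * m)) (exprS q (2 * m + s)) exprD; ring.
rewrite /warnaar_term /lhs_cell /inner_alpha /base_alpha /c.
have -> : qpoch (q ^+ 2) q (2 * (2 * m + s)) = (1 - q ^+ 2) * qpoch (q ^+ 3) q (4 * m + s) *
    warnaar_weight q (a m * b m) s / (1 - q ^+ (4 * m + 2)) by rewrite -weightE mulfK.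
have -> : (m * m + m + (k - 1) * (4 * m ^ 2 + 4 * m) =
    (k - 1) * (4 * m ^ 2 + 4 * m) + m * m.-1 + 2 * m)%N.
  by rewrite (_ : m * m + m = m * m.-1 + 2 * m)%N 1?addnC ?addnA //; case: (m) => //= m'; lia.
rewrite [q ^+ (_ + _ + 2 * m)]exprD (exprD q (_ * _) (_ * _)) [q ^+ (2 * m + s)]exprD.
by field; rewrite n1 n2 n3 n4 n5 n6.
Qed.

Let ab_lt m : `|a m * b m| < rho.
Proof.
rewrite /a /b mulrACA mulfV // mul1r -exprD normrX addnS exprS -[ltRHS]mulr1.
by rewrite (ltr_pM2l rho_gt0) exprn_ilt1.
Qed.

Let A m := series_sum (theta (a m)).
Let B m := series_sum (theta (b m)).

(** The -1 of [warnaar_identity] is grouped with the b part, where it removes the s = 0 term of the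
    theta series. *)
Let lhs_column m : P * series_sum (lhs_cell m) = c m * A m + c m * (B m - 1).
Proof.
have [K hK] := lhs_cell_le.
have d1 : geo_dominated q (lhs_cell m) (K * rho ^+ (3 * m)) by move=> s; exact: hK.
have [L hL] := warnaar_dominated q_lt1 q_complete (addr_ge0 (normr_ge0 (a m)) (normr_ge0 (b m))).
have d2 : geo_dominated q (warnaar_term q (a m) (b m)) L by apply: hL; rewrite ?lerDl ?lerDr.
rewrite -(geo_sumZ q_complete P d1).
have -> : (fun s => P * lhs_cell m s) = (fun s => c m * warnaar_term q (a m) (b m) s).
  by apply/funext => s; rewrite lhs_columnE.
rewrite (geo_sumZ q_complete _ d2) warnaar_identity // -/(A m) -/(B m); ring.
Qed.

(** The second right-hand sum starts at m = 1, and its index m belongs to coefficient m - 1 on the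
    left; s + 1 appears because its theta series lacks the s = 0 term. *)
Let rhs_cell (m s : nat) : C :=
  c m * theta (a m) s + (if m is m'.+1 then c m' * theta (b m') s.+1 else 0).

Let rhs_expo_first m s :
  (-1) ^+ (m + (2 * m + s)) * z ^ ((2 * m + s)%N%:Z - 2 * m%:Z)
    * q ^ (rhs_expo (2 * m + s) m + 4 * (k%:Z - 1) * (m%:Z ^+ 2 + m%:Z))
  = c m * theta (a m) s.
Proof.
rewrite rhs_expoE.
have -> : (2 * m + s)%N%:Z - 2 * m%:Z = Posz s by lia.
have -> : Posz (m * m + m + 2 * m * s + s + 'C(s, 2)) + 4 * (k%:Z - 1) * (m%:Z ^+ 2 + m%:Z)
   = Posz ((m * m + m + (k - 1) * (4 * m ^ 2 + 4 * m)) + ((2 * m).+1 * s + 'C(s, 2))).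
  by rewrite expr2; case: (k) k_ge2 => // k' _; rewrite subn1 /=; lia.
rewrite -!exprnP /c /partial_theta_term /a exprMn -exprM [q ^+ (_ + (_ + _))]exprD.
rewrite [q ^+ ((2 * m).+1 * s + _)]exprD (_ : m + (2 * m + s) = m + s + 2 * m)%N; last by lia.
by rewrite exprD [(-1) ^+ (2 * m)]exprM sqrrN expr1n expr1n exprD; ring.
Qed.

Let rhs_expo_second m s :
  (-1) ^+ (m.+1 + (2 * m.+1 + s)) * z ^ (2 * m.+1%:Z - (2 * m.+1 + s)%N%:Z - 1)
    * q ^ (rhs_expo (2 * m.+1 + s) m.+1 + 4 * (k%:Z - 1) * (m.+1%:Z ^+ 2 - m.+1%:Z))
  = c m * theta (b m) s.+1.
Proof.
rewrite rhs_expoE.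
have -> : 2 * m.+1%:Z - (2 * m.+1 + s)%N%:Z - 1 = Negz s by lia.
have -> : Posz (m.+1 * m.+1 + m.+1 + 2 * m.+1 * s + s + 'C(s, 2)) +
     4 * (k%:Z - 1) * (m.+1%:Z ^+ 2 - m.+1%:Z)
   = Posz ((m * m + m + (k - 1) * (4 * m ^ 2 + 4 * m)) + ((2 * m).+2 * s.+1 + 'C(s.+1, 2))).
  by rewrite binS bin1 expr2; case: (k) k_ge2 => // k' _; rewrite subn1 /=; lia.
have -> : z ^ Negz s = z^-1 ^+ s.+1 by rewrite exprVn.
rewrite -exprnP.
rewrite /c /partial_theta_term /b exprMn -exprM [q ^+ (_ + (_ + 'C(_, _)))]exprD.
rewrite [q ^+ ((2 * m).+2 * s.+1 + _)]exprD
  (_ : m.+1 + (2 * m.+1 + s) = m + s.+1 + 2 * m.+1)%N; last by lia.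
by rewrite exprD [(-1) ^+ (2 * m.+1)]exprM sqrrN expr1n expr1n exprD; ring.
Qed.

Let rhs_termE n : rhs_term q z k n = \sum_(0 <= m < (n %/ 2).+1) rhs_cell m (n - 2 * m).
Proof.
rewrite /rhs_term /rhs_cell big_split /=; congr (_ + _).
  apply: eq_big_nat => m /andP[_ hm].
  have e : n = (2 * m + (n - 2 * m))%N by lia.
  by rewrite -rhs_expo_first -e.
rewrite [RHS]big_ltn // add0r; apply: eq_big_nat => -[|m] // /andP[_ hm].
have e : n = (2 * m.+1 + (n - 2 * m.+1))%N by lia.
by rewrite -rhs_expo_second -e.
Qed.

Let rhs_cell_le : exists K : C, forall m s, `|rhs_cell m s| <= K * rho ^+ (3 * m) * rho ^+ s.
Proof.
have [Ka Ka0 ha] := theta_uniform z; have [Kb Kb0 hb] := theta_uniform z^-1.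
(* The division by rho^3 pays for the shift from m to m - 1 in the second part. *)
exists (Ka + Kb / rho ^+ 3) => m s; apply: le_trans (ler_normD _ _) _.
rewrite -mulrA mulrDl; apply: lerD.
  rewrite normrM mulrCA; apply: ler_pM => //; exact: ha.
case: m => [|m]; first by rewrite normr0 !mulr_ge0 // invr_ge0.
have -> : Kb / rho ^+ 3 * (rho ^+ (3 * m.+1) * rho ^+ s) = rho ^+ (3 * m) * (Kb * rho ^+ s).
  by rewrite mulnS exprD; field; rewrite normr_eq0.
rewrite normrM; apply: ler_pM => //; apply: le_trans (hb _ _ _) _ => //.
by apply: ler_wpM2l => //; apply: rhoX_le.
Qed.

Let thetaS_sum (y : C) : series_sum (fun s => theta y s.+1) = series_sum (theta y) - 1.
Proof.
have [K hK] := partial_theta_dominated q_neq0 q_complete y.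
apply: series_sumE.
have e n : psum (theta y) n.+1 = 1 + psum (fun s => theta y s.+1) n.
  by rewrite /psum big_ord_recl {1}/partial_theta_term bin0n !expr0 !mulr1.
have -> : psum (fun s => theta y s.+1) = (fun n => psum (theta y) n.+1 - 1).
  by apply/funext => n; rewrite e addrC addKr.
have h := geo_cvg q_complete hK; rewrite -(cvg_shiftS (psum (theta y))) in h.
exact: (cvgB h (cvg_cst (1 : C))).
Qed.

Let X m := c m * A m.
Let Y m := c m * (B m - 1).

Let theta_sum_le (K y : C) : geo_dominated q (theta y) K -> `|series_sum (theta y)| <= K / (1 - rho).
Proof. exact: geo_sum_le. Qed.

Let X_dom : exists K, geo_dominated q X K.
Proof.
have [K K0 hK] := theta_uniform z; exists (K / (1 - rho)) => m.
rewrite normrM mulrC; apply: ler_pM => //; first exact: theta_sum_le (hK _ (a_le m)).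
by apply: le_trans (c_le m) _; apply: rhoX_le; lia.
Qed.

Let Y_dom : exists K, geo_dominated q Y K.
Proof.
have [K K0 hK] := theta_uniform z^-1; exists (K / (1 - rho) + 1) => m.
rewrite normrM mulrC; apply: ler_pM => //.
  apply: le_trans (ler_normB _ _) _; rewrite normr1 lerD2r.
  exact: theta_sum_le (hK _ (b_le m)).
by apply: le_trans (c_le m) _; apply: rhoX_le; lia.
Qed.

Let rhs_column m : series_sum (rhs_cell m) = X m + (if m is m'.+1 then Y m' else 0).
Proof.
have [Ka _ ha] := theta_uniform z; have [Kb _ hb] := theta_uniform z^-1.
have dZ (x : C) (u : nat -> C) K : geo_dominated q u K -> geo_dominated q (fun s => x * u s) (`|x| * K).
  by move=> h s; rewrite normrM -mulrA ler_wpM2l.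
have da := ha _ (a_le m).
have dS y K : geo_dominated q (theta y) K -> geo_dominated q (fun s => theta y s.+1) (K * rho).
  by move=> h s; rewrite -mulrA -exprS; exact: h.
case: m da => [|m] da.
  rewrite /rhs_cell addr0 /X -(geo_sumZ q_complete _ da); congr series_sum.
  by apply/funext => s; rewrite addr0.
have db := dS _ _ (hb _ (b_le m)).
rewrite (geo_sumD q_complete (dZ _ _ _ da) (dZ _ _ _ db)).
by rewrite (geo_sumZ q_complete _ da) (geo_sumZ q_complete _ db) thetaS_sum.
Qed.

Lemma hecke_rogers_identity :
  [/\ series_cvg (lhs_term q z k), series_cvg (rhs_term q z k)
    & P * series_sum (lhs_term q z k) = series_sum (rhs_term q z k)].
Proof.
have [K hK] := lhs_cell_le; have [L hL] := rhs_cell_le.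
have hl := triangle_cvg q_lt1 q_complete hK.
have hr := triangle_cvg q_lt1 q_complete hL.
have el : lhs_term q z k = (fun n => \sum_(0 <= m < (n %/ 2).+1) lhs_cell m (n - 2 * m)).
  by apply/funext => n; exact: lhs_termE.
have er : rhs_term q z k = (fun n => \sum_(0 <= m < (n %/ 2).+1) rhs_cell m (n - 2 * m)).
  by apply/funext => n; exact: rhs_termE.
rewrite -el in hl; rewrite -er in hr.
split; first by rewrite /series_cvg seriesE; exact: cvgP hl.
  by rewrite /series_cvg seriesE; exact: cvgP hr.
rewrite (series_sumE hl) (series_sumE hr).
rewrite -(geo_sumZ q_complete P (column_sum_dominated q_lt1 q_complete hK)).
have [KX dX] := X_dom; have [KY dY] := Y_dom.
transitivity (series_sum X + series_sum Y).
  rewrite -(geo_sumD q_complete dX dY); congr series_sum.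
  by apply/funext => m; rewrite lhs_column.
apply/esym/series_sumE.
have hX := geo_cvg q_complete dX; have hY := geo_cvg q_complete dY.
(* The first n + 1 right-hand columns contain X up to index n but Y only up to n - 1, so the partial
   sums of X are shifted by one before adding. *)
rewrite -(cvg_shiftS (psum X)) in hX; rewrite -cvg_shiftS.
rewrite (_ : [sequence _]_n = (fun n => psum X n.+1 + psum Y n)); first exact: (cvgD hX hY).
apply/funext => n /=.
rewrite /psum (eq_bigr _ (fun (i : 'I_n.+1) _ => rhs_column i)) big_split /=; congr (_ + _).
by rewrite big_ord_recl /= add0r.
Qed.

End Identity.

(** * Completeness of the complex numbers *)

Lemma series_cvg_eps (C : numFieldType) (u : nat -> C) (l : C) :
  (forall e : C, 0 < e -> exists N, forall n, (N <= n)%N -> `|l - psum u n| <= e) ->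
  series_cvg u.
Proof.
move=> h; have hl : psum u @ \oo --> l.
  by apply/cvgrPdist_le => e /h [N hN]; exists N => // n /hN.
by rewrite /series_cvg seriesE; exact: cvgP hl.
Qed.

Lemma real_geo_series (R : realType) (v : nat -> R) (k r : R) :
  0 <= r -> r < 1 -> (forall n, `|v n| <= k * r ^+ n) ->
  exists l, forall e : R, 0 < e -> exists N, forall n, (N <= n)%N -> `|l - psum v n| <= e.
Proof.
move=> r0 r1 h.
have cv : cvgn (series v).
  apply: normed_cvg; apply: (@series_le_cvg _ _ (geometric k r)) => [n|n|n|].
  - exact: normr_ge0.
  - exact: le_trans (normr_ge0 (v n)) (h n).
  - exact: h.
  - by apply: is_cvg_geometric_series; rewrite ger0_norm.
exists (limn (series v)) => e e0.
have /cvgrPdist_le /(_ _ e0) [N _ hN] := cv.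
by exists N => n /hN; rewrite seriesE.
Qed.

Section ComplexComplete.
Variable R : realType.
Local Open Scope complex_scope.

Lemma norm_real_complex (x : R) : `|x%:C| = `|x|%:C.
Proof. by rewrite normc_def /= expr0n addr0 sqrtr_sqr. Qed.

Lemma norm_complex_le (x : R[i]) : `|x| <= (`|complex.Re x| + `|complex.Im x|)%:C.
Proof.
rewrite {1}[x]complexE; apply: le_trans (ler_normD _ _) _.
rewrite normrM !norm_real_complex normc_def /= expr0n expr1n add0r sqrtr1 mul1r.
by rewrite -rmorphD.
Qed.

Lemma norm_Im_le (x : R[i]) : `|complex.Im x|%:C <= `|x|.
Proof. by rewrite normc_def lecR -sqrtr_sqr ler_wsqrtr // lerDr sqr_ge0. Qed.

Lemma ge0_complexE (x : R[i]) : 0 <= x -> x = (complex.Re x)%:C.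
Proof. by case: x => a b; rewrite lecE /= => /andP[/eqP -> _]. Qed.

(** Nonnegative elements of [R[i]] are real, so K, |q| and e come from R; the real and imaginary
    parts are then compared with a real geometric series, with e / 2 for each. *)
Lemma complex_geo_complete (q : R[i]) : `|q| < 1 -> geo_complete q.
Proof.
move=> q1 u K h.
have K0 := geo_dominated_ge0 h.
set k := complex.Re K; set r := complex.Re `|q|.
have Kk : K = k%:C by exact: ge0_complexE.
have qr : `|q| = r%:C by exact: ge0_complexE.
have r0 : 0 <= r by rewrite -lecR -qr; exact: (normr_ge0 q).
have r1 : r < 1 by rewrite -ltcR -qr; exact: q1.
have hre n : `|complex.Re (u n)| <= k * r ^+ n.
  rewrite -lecR; apply: le_trans (normc_ge_Re _) _.
  by apply: le_trans (h n) _; rewrite Kk qr rmorphM rmorphXn.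
have him n : `|complex.Im (u n)| <= k * r ^+ n.
  rewrite -lecR; apply: le_trans (norm_Im_le _) _.
  by apply: le_trans (h n) _; rewrite Kk qr rmorphM rmorphXn.
have [x hx] := real_geo_series r0 r1 hre; have [y hy] := real_geo_series r0 r1 him.
apply: (@series_cvg_eps _ _ (x +i* y)) => e e0.
have ee : e = (complex.Re e)%:C by apply: ge0_complexE; exact: ltW.
set e' := complex.Re e in ee.
have e'0 : 0 < e' / 2 by rewrite divr_gt0 // -ltcR -ee; exact: e0.
have [N1 h1] := hx _ e'0; have [N2 h2] := hy _ e'0.
exists (maxn N1 N2) => n; rewrite geq_max => /andP[/h1 n1 /h2 n2].
apply: le_trans (norm_complex_le _) _; rewrite ee lecR.
have -> : psum u n = psum (fun i => complex.Re (u i)) n +i* psum (fun i => complex.Im (u i)) n.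
  elim: n {n1 n2} => [|n IH]; first by rewrite !psum0.
  by rewrite !psumS IH; case: (u n).
by rewrite [leRHS]splitr /= lerD.
Qed.

End ComplexComplete.

Theorem theorem1p4 (R : realType) (q z : R[i]) (k : nat)
    (q_gt0 : 0 < `|q|) (q_lt1 : `|q| < 1) (z_neq0 : z != 0)
    (z_neq : forall m : int, m != 0 -> z != q ^ m) (k_ge2 : (2 <= k)%N) :
  [/\ series_cvg (lhs_term q z k),
      series_cvg (rhs_term q z k)
    & qpochoo (z * q) q * qpochoo (z^-1 * q) q * qpochoo q q
        * series_sum (lhs_term q z k)
      = series_sum (rhs_term q z k)].
Proof.
have q_neq0 : q != 0 by rewrite -normr_gt0.
exact: hecke_rogers_identity q_neq0 q_lt1 z_neq0 z_neq k_ge2 (complex_geo_complete q_lt1).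
Qed.
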